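(* Let $X$ be a real Hilbert space, $0<\alpha<1$, $T>0$, and let $A:X\supset\mathcal{D}(A)\to X$ be a closed densely defined linear operator such that $\{\lambda\in\mathbb{R};\ \lambda>0\}\subset\rho(A)$ and $\lambda\|(\lambda-A)^{-1}\|_{X\to X}\le 1$ for all $\lambda>0$. Let $a\in X$. If $u\in L^2(0,T;X)$ is a weak solution to $\partial_t^\alpha(u(t)-a)=Au(t)$ in $X$ for $0<t<T$, then $$u\in C([0,T];X),\qquad u(0)=a.$$
   Context: $L^2(0,T;X)$ is the Hilbert space of (classes of) strongly measurable, square-integrable functions $(0,T)\to X$ with scalar product $(v,w)_{L^2(0,T;X)}=\int_0^T (v(t),w(t))_X\,dt$. $\rho(A)$ denotes the resolvent set of $A$. $\mathcal{D}(A)$ carries the graph norm $\|u\|_X+\|Au\|_X$. The operator $\mathcal{A}$ in $L^2(0,T;X)$ has domain $\mathcal{D}(\mathcal{A})=L^2(0,T;\mathcal{D}(A))$ and acts by $(\mathcal{A}u)(t)=Au(t)$; $\mathcal{A}^*$ is its adjoint with respect to the scalar product of $L^2(0,T;X)$. For $v\in L^2(0,T;X)$ set $J^\alpha v(t)=\frac{1}{\Gamma(\alpha)}\int_0^t (t-s)^{\alpha-1}v(s)\,ds$; $J^\alpha$ is bounded and injective on $L^2(0,T;X)$. Define $\partial_t^\alpha:=(J^\alpha)^{-1}$ with domain $\mathcal{D}(\partial_t^\alpha)=J^\alpha L^2(0,T;X)$, which is dense in $L^2(0,T;X)$; $(\partial_t^\alpha)^*$ is its adjoint with respect to the scalar product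 of $L^2(0,T;X)$. Weak solution: $u\in L^2(0,T;X)$ is a weak solution to $\partial_t^\alpha(u-a)=Au$ if $$(u-a,(\partial_t^\alpha)^*\varphi)_{L^2(0,T;X)}=(u,\mathcal{A}^*\varphi)_{L^2(0,T;X)}\quad\text{for all }\varphi\in\mathcal{D}((\partial_t^\alpha)^* )\cap\mathcal{D}(\mathcal{A}^* ),$$ where $a$ is regarded as a constant function of $t$. ''$u\in C([0,T];X)$'' means that $u$ has a representative continuous on $[0,T]$, with which $u$ is identified. *)

(* Defs.v *)
From HB Require Import structures.
From mathcomp Require Import all_boot all_order all_algebra sesquilinear.
From mathcomp Require Import all_classical all_reals all_analysis.

Set Implicit Arguments.
Unset Strict Implicit.
Unset Printing Implicit Defensive.

Import Order.TTheory GRing.Theory Num.Theory.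
Import numFieldNormedType.Exports.

Local Open Scope classical_set_scope.
Local Open Scope ring_scope.

(* MathComp-Analysis has no inner product spaces: a real Hilbert space is a
   complete normed module X with a dot product ip inducing its norm. *)
Definition induces_norm (R : realType) (X : normedModType R)
    (ip : {dot X for (@idfun R)}) : Prop :=
  forall x : X, `|x| = Num.sqrt (ip x x).

Section UnboundedOperators.
Variables (R : realType) (X : normedModType R).

(* Only the values of opfun on dom are meaningful. *)
Record unbounded_operator := UnboundedOperator {
  dom : set X ;
  opfun :> X -> X ;
  dom0 : dom 0 ;
  domP : forall (c : R) x y, dom x -> dom y -> dom (c *: x + y) ;
  opfunP : forall (c : R) x y, dom x -> dom y ->
    opfun (c *: x + y) = c *: opfun x + opfun y
}.

Variable A : unbounded_operator.

Definition op_graph : set (X * X) := [set p | dom A p.1 /\ p.2 = A p.1].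

Definition closed_operator : Prop := closed op_graph.

Definition densely_defined : Prop := dense (dom A).

Definition graph_norm (x : X) : R := `|x| + `|A x|.

Definition resolvent (l : R) (x : X) : X :=
  xget 0 [set y | dom A y /\ l *: y - A y = x].

Definition resolvent_set : set R :=
  [set l | set_bij (dom A) setT (fun y => l *: y - A y) /\
           bounded_fun_norm (resolvent l)].

Definition operator_norm (S : X -> X) : R :=
  sup [set `|S x| | x in [set x : X | `|x| <= 1]].

End UnboundedOperators.

Section VectorValuedIntegration.
Variables (R : realType) (X : normedModType R).

Local Notation mu := (@lebesgue_measure R).

Definition simple_on (D : set R) (E : set X) (s : R -> X) : Prop :=
  [/\ finite_set (s @` D), s @` D `<=` E &
      forall x, measurable (D `&` s @^-1` [set x])].

(* Strong measurability on D of a function with values in the linear subspace E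
   of X normed by N; for the space X itself, take E := setT and N := Num.norm.
   Such a function agrees with a Borel function only almost everywhere.  The
   library's integral of a function >= 0 is a supremum over simple minorants,
   so it does not see the exceptional null set. *)
Definition strongly_measurable (D : set R) (E : set X) (N : X -> R)
    (u : R -> X) : Prop :=
  exists s : nat -> R -> X,
    (forall n, simple_on D E (s n)) /\
    {ae mu, forall t, D t ->
      E (u t) /\ N (s n t - u t) @[n --> \oo] --> (0 : R)}.

Definition simple_integral (D : set R) (s : R -> X) : X :=
  \sum_(x \in s @` D) fine (mu (D `&` s @^-1` [set x])) *: x.

Definition has_bochner_integral (D : set R) (f : R -> X) (w : X) : Prop :=
  strongly_measurable D setT Num.norm f /\
  exists s : nat -> R -> X,
    [/\ forall n, simple_on D setT (s n),
        (\int[mu]_(t in D) (`|s n t - f t|)%:E)%E @[n --> \oo] --> 0%E &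
        simple_integral D (s n) @[n --> \oo] --> w].

(* 0 if f is not Bochner integrable *)
Definition bochner_integral (D : set R) (f : R -> X) : X :=
  xget 0 [set w | has_bochner_integral D f w].

(* L^2(0, T; E) for E normed by N.  Classes of functions are represented by
   functions R -> X, equality of classes is a.e. equality on `]0, T[, and values outside
   `]0, T[ are irrelevant. *)
Definition L2_in (T : R) (E : set X) (N : X -> R) (u : R -> X) : Prop :=
  strongly_measurable `]0, T[ E N u /\
  (\int[mu]_(t in `]0%R, T[) ((N (u t)) ^+ 2)%:E < +oo)%E.

Definition L2 (T : R) (u : R -> X) : Prop := L2_in T setT Num.norm u.

End VectorValuedIntegration.

Section FractionalCalculus.
Variables (R : realType) (X : normedModType R).

Local Notation mu := (@lebesgue_measure R).

Definition Gamma (a : R) : R :=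
  \int[mu]_(t in `]0, +oo[) (t `^ (a - 1) * expR (- t)).

Definition frac_integral (alpha : R) (v : R -> X) (t : R) : X :=
  (Gamma alpha)^-1 *:
    bochner_integral `]0, t[ (fun s => (t - s) `^ (alpha - 1) *: v s).

(* An operator in L^2(0, T; X) is given by its graph, a relation between
   representatives: G u w means that u is in the domain and that w represents
   the image of u. *)

(* graph of the inverse of frac_integral alpha *)
Definition frac_derivative (T alpha : R) (v w : R -> X) : Prop :=
  [/\ L2 T v, L2 T w & v = frac_integral alpha w %[ae mu in `]0, T[%classic]].

Definition pointwise_operator (T : R) (A : unbounded_operator X)
    (u w : R -> X) : Prop :=
  [/\ L2_in T (dom A) (graph_norm A) u, L2 T w &
      w = (fun t => A (u t)) %[ae mu in `]0, T[%classic]].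

Variable ip : {dot X for (@idfun R)}.

Definition L2_dot (T : R) (v w : R -> X) : R :=
  \int[mu]_(t in `]0, T[) ip (v t) (w t).

Definition L2_adjoint (T : R) (G : (R -> X) -> (R -> X) -> Prop)
    (phi psi : R -> X) : Prop :=
  [/\ L2 T phi, L2 T psi &
      forall v w, G v w -> L2_dot T w phi = L2_dot T v psi].

Definition weak_solution (T alpha : R) (A : unbounded_operator X) (a : X)
    (u : R -> X) : Prop :=
  forall phi psi chi : R -> X,
    L2_adjoint T (@frac_derivative T alpha) phi psi ->
    L2_adjoint T (pointwise_operator T A) phi chi ->
    L2_dot T (fun t => u t - a) psi = L2_dot T u chi.

End FractionalCalculus.

(* Main.v *)
(* For l > 0 let J = (l - A)^-1, and let V be the primitive of u.  Testing the weak
   formulation with multiples of J^* x gives J (V - t a) = I^alpha (l J V - V), where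
   V need not lie in the domain of A.  At a maximum of a function F = I^alpha g one
   has F(t) <= C t^alpha g(t)^+; with <A x, x> <= 0 this yields a maximum principle
   for the equation.  Extend V by t a to negative times and let Y_h be its backward
   difference quotients.  The principle shows that J Y_h is Cauchy in C([0, T]; X) as
   h -> 0 and that |L Y_h| <= |L a| for L = n (n - A)^-1 - 1.  As L a -> 0 when
   n -> oo, the Y_h themselves converge uniformly.  Their limit is continuous, equals
   a at 0, and is almost everywhere the derivative u of V. *)

Require Import Defs.
From HB Require Import structures.
From mathcomp Require Import all_boot all_order all_algebra sesquilinear.
From mathcomp Require Import all_classical all_reals all_analysis.
From mathcomp Require Import finmap measurable_realfun.
From mathcomp Require Import ring lra.

Set Implicit Arguments.
Unset Strict Implicit.
Unset Printing Implicit Defensive.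

Import Order.TTheory GRing.Theory Num.Theory.
Import numFieldNormedType.Exports.

Local Open Scope classical_set_scope.
Local Open Scope ring_scope.

(** * Hilbert spaces *)

(** The weak formulation sees [u] only in the mean. A test function whose adjoint fractional
    derivative is the indicator of ]0, tau[ turns it into a statement about V at each single time
    tau; this is why V is studied in place of [u]. The obstacle is that neither V nor [a] need lie
    in the domain of A. In the equation for Y_h the datum enters with the factor 1 - phi_h, where
    phi_h is the difference quotient of t^+ and equals 1 for t >= h, so the maximum principle leaves
    an error of order |A J a| h^alpha. Nothing controls |A J a| as l -> oo, hence J cannot simply be
    removed from J Y_h. Two devices help. For a bounded L commuting with the resolvents, J L Y_h is
    a difference quotient; cutting its step into many small ones removes the error and leaves |J L
    Y_h| <= |J L a|, where l -> oo is harmless. And the splitting Y = l J Y - L Y, with L = l J - 1,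
    separates a part that is Cauchy for fixed l from a part that is small uniformly in h. *)

Lemma cauchy_seq_cvg {R : realType} {X : completeNormedModType R} (y : nat -> X) :
  (forall e : R, 0 < e -> exists N, forall i j, (N <= i)%N -> (N <= j)%N ->
     `|y i - y j| <= e) -> cvg (y @ \oo).
Proof.
move=> h; apply/cauchy_cvgP/cauchy_exP => e e0.
have [|N HN] := h (e / 2); first by rewrite divr_gt0.
exists (y N), N => // n /= Nn; rewrite -ball_normE /=.
by rewrite (le_lt_trans (HN _ _ _ _))// ltr_pdivrMr// ltr_pMr// ltr1n.
Qed.

Section InnerProduct.
Context {R : realType} {X : completeNormedModType R}.
Variable ip : {dot X for (@idfun R)}.
Hypothesis hip : induces_norm ip.
Implicit Types x y z : X.

Lemma ipDl x y z : ip (x + y) z = ip x z + ip y z.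
Proof. by rewrite linearDl. Qed.

Lemma ipZl (c : R) x y : ip (c *: x) y = c * ip x y.
Proof. by rewrite linearZl_LR. Qed.

Lemma ipC x y : ip x y = ip y x.
Proof. by rewrite (@hermC R false idfun X ip) expr0 mul1r. Qed.

Lemma ipDr x y z : ip x (y + z) = ip x y + ip x z.
Proof. by rewrite ipC ipDl ![ip _ x]ipC. Qed.

Lemma ipZr (c : R) x y : ip x (c *: y) = c * ip x y.
Proof. by rewrite ipC ipZl ipC. Qed.

Lemma ip0l x : ip 0 x = 0.
Proof. by rewrite -(scale0r 0) ipZl mul0r. Qed.

Lemma ip0r x : ip x 0 = 0.
Proof. by rewrite ipC ip0l. Qed.

Lemma ipNl x y : ip (- x) y = - ip x y.
Proof. by rewrite -scaleN1r ipZl mulN1r. Qed.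

Lemma ipNr x y : ip x (- y) = - ip x y.
Proof. by rewrite ipC ipNl ipC. Qed.

Lemma ipBl x y z : ip (x - y) z = ip x z - ip y z.
Proof. by rewrite ipDl ipNl. Qed.

Lemma ipBr x y z : ip x (y - z) = ip x y - ip x z.
Proof. by rewrite ipDr ipNr. Qed.

Definition ipE := (ipDl, ipDr, ipNl, ipNr, ipZl, ipZr).

Lemma ipxx x : ip x x = `|x| ^+ 2.
Proof.
have [->|x0] := eqVneq x 0; first by rewrite normr0 ip0l expr0n.
by rewrite hip sqr_sqrtr// ltW// neq0_dnorm_gt0.
Qed.

Lemma le_ip x y : ip x y <= `|x| * `|y|.
Proof.
have [->|x0] := eqVneq x 0; first by rewrite normr0 ip0l mul0r.
have [->|y0] := eqVneq y 0; first by rewrite normr0 ip0r mulr0.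
(* The square of this norm is 2 |x| |y| (|x| |y| - ip x y). *)
have := ipxx (`|y| *: x - `|x| *: y).
have := sqr_ge0 (`| `|y| *: x - `|x| *: y|); rewrite -ipxx.
rewrite !ipE !ipxx (ipC y x) => + _.
have y0' : 0 < `|y| by rewrite normr_gt0.
have x0' : 0 < `|x| by rewrite normr_gt0.
have xy0 : 0 < `|x| * `|y| by rewrite mulr_gt0.
rewrite -subr_ge0 => h; rewrite -subr_ge0 -(pmulr_rge0 _ xy0).
nra.
Qed.

Lemma norm_ip x y : `|ip x y| <= `|x| * `|y|.
Proof.
by rewrite ler_norml le_ip andbT lerNl -ipNl (le_trans (le_ip _ _))// normrN.
Qed.

Lemma eq_ip x y : (forall z, ip x z = ip y z) -> x = y.
Proof.
move=> h; apply/eqP; rewrite -subr_eq0 -normr_eq0 -sqrf_eq0 -ipxx.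
by rewrite ipBl h subrr.
Qed.

Lemma parallelogram x y :
  `|x - y| ^+ 2 = 2 * `|x| ^+ 2 + 2 * `|y| ^+ 2 - `|x + y| ^+ 2.
Proof. by rewrite -!ipxx !ipE (ipC y x); ring. Qed.

Lemma continuous_ipl z : continuous (ip^~ z).
Proof.
move=> x; apply/cvgrPdist_lt => e e0.
have z0 : 0 < `|z| + 1 by rewrite ltr_wpDl.
near=> t; rewrite -ipBl (le_lt_trans (norm_ip _ _))//.
rewrite (@le_lt_trans _ _ (`|x - t| * (`|z| + 1)))//.
  by rewrite ler_wpM2l// lerDl.
rewrite -ltr_pdivlMr//; near: t.
by apply: (@cvgr_dist_lt _ _ _ (nbhs x) _ id x) => //; rewrite divr_gt0.
Unshelve. all: end_near. Qed.

(* The representing vector minimises `|y| ^+ 2 - 2 * F y. *)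
Lemma riesz (F : X -> R) (C : R) :
  (forall c x y, F (c *: x + y) = c * F x + F y) ->
  (forall x, `|F x| <= C * `|x|) ->
  exists y, forall x, F x = ip x y.
Proof.
move=> Flin FC.
have FD x y : F (x + y) = F x + F y by rewrite -[x]scale1r Flin mul1r scale1r.
have F0 : F 0 = 0.
  have := FD 0 0; rewrite addr0 => /eqP; rewrite -subr_eq0 opprD addrA subrr sub0r.
  by rewrite oppr_eq0 => /eqP.
have FZ c x : F (c *: x) = c * F x by rewrite -[c *: x]addr0 Flin F0 addr0.
pose J y : R := `|y| ^+ 2 - 2 * F y.
have Jlb y : - C ^+ 2 <= J y.
  have := FC y; rewrite ler_norml => /andP[_ h].
  rewrite /J; have := sqr_ge0 (`|y| - C); nra.
pose m := inf (range J).
have hinf : has_inf (range J).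
  by split; [exists (J 0), 0|exists (- C ^+ 2) => _ [y _ <-]].
have mJ y : m <= J y by apply: ge_inf; [exact: hinf.2|exists y].
have /choice[y_ yP] : forall n : nat, exists y, J y < m + n.+1%:R^-1.
  move=> n; have e0 : 0 < (n.+1%:R^-1 : R) by rewrite invr_gt0.
  by have [_ [y _ <-]] := inf_adherent e0 hinf; exists y.
(* The parallelogram law reads |y - z|^2 = 2 J y + 2 J z - 4 J ((y + z) / 2), and the midpoint value
   is at least m. Hence minimising sequences are Cauchy. *)
have Jdist y z e : J y < m + e -> J z < m + e -> `|y - z| ^+ 2 <= 4 * e.
  move=> hy hz; rewrite parallelogram.
  have := mJ (2^-1 *: (y + z)); rewrite /J.
  rewrite normrZ FZ FD exprMn normfV ger0_norm//.
  by move: hy hz; rewrite /J; lra.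
have /cvg_ex[y yl] : cvg (y_ @ \oo).
  apply: cauchy_seq_cvg => e e0.
  have e1 : 0 < e ^+ 2 / 4 by rewrite divr_gt0// exprn_gt0.
  have [N _ HN] := near_infty_natSinv_lt (PosNum e1).
  exists N => i j Ni Nj; rewrite -(@ler_pXn2r _ 2)// ?nnegrE ?(ltW e0)//.
  rewrite [leRHS](_ : _ = 4 * (e ^+ 2 / 4)); last by rewrite mulrC divfK.
  apply: Jdist; apply: (lt_trans (yP _)); rewrite ltrD2l; exact: HN.
have Jym : J y <= m.
  apply/ler_addgt0Pr => e e0.
  have cJ : J (y_ n) @[n --> \oo] --> J y.
    apply: cvgB.
      by under eq_fun do rewrite expr2; rewrite expr2; apply: cvgM; exact: cvg_norm.
    apply: cvgMr; apply/cvgrPdist_lt => d d0.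
    have C0 : 0 < `|C| + 1 by rewrite ltr_wpDl.
    near=> n; rewrite -[F y]mul1r -[F (y_ n)]mul1r -mulrBr mul1r.
    have -> : F y - F (y_ n) = F (y - y_ n).
      by rewrite -[- y_ n]scaleN1r [in RHS]addrC Flin mulN1r addrC.
    rewrite (le_lt_trans (FC _))//.
    rewrite (@le_lt_trans _ _ ((`|C| + 1) * `|y - y_ n|))//.
      by rewrite ler_wpM2r// ler_wpDr// ler_norm.
    rewrite -ltr_pdivlMl//; near: n.
    by move/cvgrPdist_lt : yl; apply; rewrite mulr_gt0// invr_gt0.
  apply: (cvgr_to_le cJ).
  near=> n; apply: ltW; apply: (lt_trans (yP n)); rewrite ltrD2l.
  near: n; exact: (near_infty_natSinv_lt (PosNum e0)).
exists y => x; rewrite ipC.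
(* Comparing J at y and at y + t x gives a quadratic in t that is never negative, so its linear
   coefficient must vanish. The test value of t below has |x|^2 + 1 as denominator to stay defined
   at x = 0. *)
have key t : 0 <= t ^+ 2 * `|x| ^+ 2 + 2 * t * (ip y x - F x).
  have := le_trans Jym (mJ (t *: x + y)).
  rewrite /J Flin -!ipxx !ipE (ipC x y); nra.
apply/eqP; rewrite -subr_eq0 -oppr_eq0 opprB; apply/negPn/negP => d0.
set d := ip y x - F x in key d0 *.
have n0 : 0 < `|x| ^+ 2 + 1 by rewrite ltr_wpDl// sqr_ge0.
have := key (- d / (`|x| ^+ 2 + 1)).
set N := `|x| ^+ 2 + 1 in n0 *.
have -> : (- d / N) ^+ 2 * `|x| ^+ 2 + 2 * (- d / N) * d
   = d ^+ 2 / N ^+ 2 * (`|x| ^+ 2 - 2 * N) by field; rewrite gt_eqF.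
apply/negP; rewrite -ltNge pmulr_rlt0; last first.
  by rewrite divr_gt0// exprn_even_gt0//= gt_eqF.
by rewrite /N; have := sqr_ge0 `|x|; lra.
Unshelve. all: end_near. Qed.

Lemma adjointP (L : X -> X) (M : R) :
  (forall c x y, L (c *: x + y) = c *: L x + L y) ->
  (forall x, `|L x| <= M * `|x|) ->
  exists L' : X -> X, forall x y, ip (L x) y = ip x (L' y).
Proof.
move=> Llin LM.
have /choice[L' HL'] : forall y, exists z, forall x, ip (L x) y = ip x z.
  move=> y; apply: (@riesz _ (M * `|y|)) => [c x z|x].
    by rewrite Llin !ipE.
  by rewrite (le_trans (norm_ip _ _))// mulrAC ler_wpM2r.
by exists L' => x y.
Qed.

End InnerProduct.

(** * Resolvents of a dissipative operator *)

Section Resolvent.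
Context {R : realType} {X : completeNormedModType R}.
Variable A : unbounded_operator X.
Hypothesis hrho : [set l : R | 0 < l] `<=` resolvent_set A.
Hypothesis hbound : forall l : R, 0 < l -> l * operator_norm (resolvent A l) <= 1.
Local Notation J := (resolvent A).

Lemma resolvent_spec (l : R) x : 0 < l -> dom A (J l x) /\ l *: J l x - A (J l x) = x.
Proof.
move=> /hrho [[_ _ sur] _].
have [y dy yx] := sur x I.
exact: (@xgetPex _ 0 [set y | dom A y /\ l *: y - A y = x] (ex_intro _ y (conj dy yx))).
Qed.

Lemma dom_resolvent (l : R) x : 0 < l -> dom A (J l x).
Proof. by move=> l0; have [] := resolvent_spec x l0. Qed.

Lemma op_resolvent (l : R) x : 0 < l -> A (J l x) = l *: J l x - x.
Proof.
by move=> l0; have [_ {3}<-] := resolvent_spec x l0; rewrite opprB addrC subrK.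
Qed.

Lemma resolvent_eq (l : R) x y : 0 < l -> dom A y -> l *: y - A y = x -> J l x = y.
Proof.
move=> l0 dy yx; have [[_ inj _] _] := hrho l0.
have [d e] := resolvent_spec x l0.
by apply: inj; [exact: mem_set..|rewrite e yx].
Qed.

Lemma resolvent_lin (l : R) c x y : 0 < l ->
  J l (c *: x + y) = c *: J l x + J l y.
Proof.
move=> l0; have dx := dom_resolvent x l0; have dy := dom_resolvent y l0.
apply: resolvent_eq => //; first exact: domP.
rewrite opfunP// !op_resolvent// scalerDr !scalerBr !scalerA (mulrC l c).
rewrite opprD !opprB addrACA; congr (_ + _); by rewrite addrC subrK.
Qed.

Lemma resolventD (l : R) x y : 0 < l -> J l (x + y) = J l x + J l y.
Proof. by move=> l0; rewrite -[x in LHS]scale1r resolvent_lin// scale1r. Qed.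

Lemma resolvent0 (l : R) : 0 < l -> J l 0 = 0.
Proof.
move=> l0; have := resolventD 0 0 l0; rewrite addr0 => /eqP.
by rewrite -subr_eq0 opprD addrA subrr sub0r oppr_eq0 => /eqP.
Qed.

Lemma resolventZ (l : R) c x : 0 < l -> J l (c *: x) = c *: J l x.
Proof. by move=> l0; rewrite -[c *: x in LHS]addr0 resolvent_lin// resolvent0// addr0. Qed.

Lemma resolventN (l : R) x : 0 < l -> J l (- x) = - J l x.
Proof. by move=> l0; rewrite -scaleN1r resolventZ// scaleN1r. Qed.

Lemma resolventB (l : R) x y : 0 < l -> J l (x - y) = J l x - J l y.
Proof. by move=> l0; rewrite resolventD// resolventN. Qed.

Lemma norm_resolvent (l : R) x : 0 < l -> l * `|J l x| <= `|x|.
Proof.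
move=> l0; have [->|x0] := eqVneq x 0; first by rewrite resolvent0// normr0 mulr0.
have x0' : 0 < `|x| by rewrite normr_gt0.
have h : `|J l (`|x|^-1 *: x)| <= operator_norm (J l).
  apply: ub_le_sup.
    (* The supremum in [operator_norm] bounds its set only once the set is known to be bounded;
       membership in the resolvent set supplies this on the unit ball. *)
    have [_ /(_ 1)[M HM]] := hrho l0.
    by exists M => _ [y /= y1 <-]; exact: HM.
  exists (`|x|^-1 *: x) => //=.
  by rewrite normrZ normfV normr_id mulVf// normr_eq0.
have := hbound l0; have := ler_wpM2l (ltW l0) h.
rewrite resolventZ// normrZ normfV normr_id => h1 h2.
have := le_trans h1 h2; rewrite mulrCA -ler_pdivlMl ?invr_gt0//.
by rewrite invrK mulr1.
Qed.

(** With z = J l (J m x), the vector m z - A z = (m - l) z + J m x is again in the domain, and l - A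
    maps it to x. So it is J l x, and z is J m of it. *)
Lemma resolventC (l m : R) x : 0 < l -> 0 < m -> J l (J m x) = J m (J l x).
Proof.
move=> l0 m0; set z := J l (J m x).
have dz : dom A z by exact: dom_resolvent.
have Az : A z = l *: z - J m x by rewrite op_resolvent.
apply/esym/resolvent_eq => //; rewrite Az.
apply/esym/resolvent_eq => //.
  rewrite opprB addrCA -scalerBl addrC; apply: domP => //; exact: dom_resolvent.
have -> : m *: z - (l *: z - J m x) = (m - l) *: z + J m x.
  by rewrite opprB addrCA -scalerBl addrC.
rewrite opfunP//; last exact: dom_resolvent.
rewrite Az op_resolvent// scalerDr !scalerBr !scalerA.
have E (a b c d : X) : (a + b) - ((a - (c - b)) + (c - d)) = d.
  by rewrite opprB (addrA a) subrKA opprB addrCA subrr addr0.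
by rewrite (mulrC l (m - l)) scalerBl E.
Qed.

(** For y in the domain, n J_n y - y = J_n (A y) has norm at most |A y| / n. Density and |n J_n| <=
    1 extend the convergence to every x. *)
Lemma yosida_cvg (hdense : densely_defined A) x e : 0 < e ->
  exists N, forall n, (N <= n)%N -> `|n.+1%:R *: J n.+1%:R x - x| <= e.
Proof.
move=> e0; have e3 : 0 < e / 3 by rewrite divr_gt0.
have [y [/= xy dy]] : ball x (e / 3) `&` dom A !=set0.
  apply: hdense; first by exists x; exact: ballxx.
  exact: ball_open.
rewrite -ball_normE /= in xy.
have e4 : 0 < e / 3 / (`|A y| + 1) by rewrite divr_gt0// ltr_wpDl.
have [N _ HN] := near_infty_natSinv_lt (PosNum e4).
exists N => n /HN/= Nn.
have n0 : (0 : R) < n.+1%:R by [].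
have -> : n.+1%:R *: J n.+1%:R x - x = n.+1%:R *: J n.+1%:R (x - y) + J n.+1%:R (A y) - (x - y).
  have -> : J n.+1%:R (A y) = n.+1%:R *: J n.+1%:R y - y.
    rewrite -resolventZ// -[X in _ = _ - X](resolvent_eq n0 dy erefl) -resolventB//.
    by rewrite opprB addrC subrK.
  by rewrite resolventB// scalerBr subrKA opprB addrA subrK.
have h1 : `|n.+1%:R *: J n.+1%:R (x - y)| <= e / 3.
  by rewrite normrZ ger0_norm// (le_trans (norm_resolvent _ n0))// ltW.
have h2 : `|J n.+1%:R (A y)| <= e / 3.
  have := norm_resolvent (A y) n0; rewrite -ler_pdivlMl// => /le_trans; apply.
  rewrite (@le_trans _ _ (n.+1%:R^-1 * (`|A y| + 1)))//.
    by rewrite ler_wpM2l// lerDl.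
  by rewrite -ler_pdivlMr ?ltr_wpDl// ltW.
rewrite (le_trans (ler_normB _ _))// (le_trans (lerD (ler_normD _ _) (lexx _)))//.
rewrite (le_trans (lerD (lerD h1 h2) (ltW xy)))//.
by lra.
Qed.

Section Dissipative.
Variable ip : {dot X for (@idfun R)}.
Hypothesis hip : induces_norm ip.

(** The resolvent bound says |l y| <= |l y - A y|. Squaring leaves 2 l ip (A y) y <= |A y|^2, and l
    may be taken as large as desired; the [l] below brings the bound under e. *)
Lemma dissipative y : dom A y -> ip (A y) y <= 0.
Proof.
move=> dy; apply/ler_addgt0Pr => e e0; rewrite add0r.
set l := (`|A y| ^+ 2 + 1) / (2 * e).
have l0 : 0 < l by rewrite divr_gt0// ?mulr_gt0// ltr_wpDl// sqr_ge0.
have h0 : `|l *: y| <= `|l *: y - A y|.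
  rewrite normrZ ger0_norm ?(ltW l0)//.
  by have := norm_resolvent (l *: y - A y) l0; rewrite (resolvent_eq l0 dy erefl).
move: h0.
rewrite -(@ler_pXn2r _ 2) ?nnegrE ?normr_ge0// -!(ipxx hip) !ipE (ipC ip (A y) y) => h.
have : 2 * l * ip y (A y) <= ip (A y) (A y) by lra.
have l20 : 0 < 2 * l by rewrite mulr_gt0.
rewrite (ipxx hip (A y)) -ler_pdivlMl// => /le_trans; apply.
rewrite ler_pdivrMl// /l.
rewrite [leRHS](_ : _ = `|A y| ^+ 2 + 1) ?lerDl//.
by field; rewrite gt_eqF.
Qed.

End Dissipative.

End Resolvent.

(** * Lebesgue integration on the line *)

Section AeIntegral.
Context d (T : measurableType d) (R : realType) (mu : {measure set T -> \bar R}).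
Local Open Scope ereal_scope.
Import HBNNSimple.

(* No measurability: a simple minorant of [f] vanishing on the exceptional null
   set is a simple minorant of [g] with the same integral. *)
Lemma ae_le_ge0_integralT (f g : T -> \bar R) :
  (forall x, 0 <= f x) -> (forall x, 0 <= g x) ->
  {ae mu, forall x, f x <= g x} -> \int[mu]_x f x <= \int[mu]_x g x.
Proof.
move=> f0 g0 [N [mN N0 sub]].
rewrite !ge0_integralTE//; apply: ge_ereal_sup => _ [h /= hf <-].
have mNC : measurable (~` N) by exact: measurableC.
pose k := mul_nnsfun h (indic_nnsfun R mNC).
have kg x : (k x)%:E <= g x.
  have -> : k x = (h x * \1_(~` N) x)%R by [].
  rewrite indicE; have [xN|xN] := boolP (x \in ~` N).
    rewrite mulr1 (le_trans (hf x))//.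
    by apply: contrapT => fg; move/set_mem: xN; apply; exact: sub.
  by rewrite mulr0 g0.
apply: ereal_sup_ubound; exists k => //.
rewrite -!integralT_nnsfun; apply: ae_eq_integral => //; try exact/measurable_EFinP.
exists N; split=> // x; apply: contra_notP => xN _.
have -> : k x = (h x * \1_(~` N) x)%R by [].
by rewrite indicE mem_set// mulr1.
Qed.

(** Free of measurability, because a representative in L^2 is only almost everywhere equal to a
    measurable function. Positive and negative parts are compared separately, in both directions. *)
Lemma ae_eq_integral_nomeas D (f g : T -> \bar R) :
  f = g %[ae mu in D] -> \int[mu]_(x in D) f x = \int[mu]_(x in D) g x.
Proof.
move=> fg; rewrite (integralE _ _ f) (integralE _ _ g).
congr (_ - _); rewrite integral_mkcond [RHS]integral_mkcond; apply/eqP; rewrite eq_le;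
  apply/andP; split; apply: ae_le_ge0_integralT => [x|x|];
  rewrite ?erestrict_ge0//; apply: filterS fg => x /= fg;
  rewrite !patchE; case: ifPn => // /set_mem/fg.
- by rewrite !funeposE => ->.
- by rewrite !funeposE => ->.
- by rewrite !funenegE => ->.
- by rewrite !funenegE => ->.
Qed.

Lemma ae_eq_Rintegral D (f g : T -> R) :
  f = g %[ae mu in D] -> (\int[mu]_(x in D) f x)%R = (\int[mu]_(x in D) g x)%R.
Proof.
move=> fg; rewrite /Rintegral; congr fine; apply: ae_eq_integral_nomeas.
by apply: filterS fg => x /= h /h ->.
Qed.

End AeIntegral.

Section Translation.
Context {R : realType}.
Local Notation mu := (@lebesgue_measure R).

Let shift_preimage_itv (h : R) a b :
  (fun x : R => x - h) @^-1` `]a, b]%classic = `]a + h, b + h]%classic.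
Proof.
by apply/seteqP; split=> x /=; rewrite !in_itv/= ltrBrDr lerBlDr.
Qed.

Let measurable_shift (h : R) :
  measurable_fun [set: R] (fun x : R => x - h : measurableTypeR R).
Proof. exact: measurable_funD. Qed.

Lemma lebesgue_measure_shift (h : R) (A : set R) : measurable A ->
  pushforward mu (fun x : R => x - h : measurableTypeR R) A = mu A.
Proof.
move=> mA; apply/esym/lebesgue_measure_unique => //=.
  exact: measurable_shift.
move=> mshift.
move=> _ [[a b] _ <-] /=.
rewrite /pushforward shift_preimage_itv !lebesgue_measure_itv/=.
by rewrite !lte_fin ltrD2r -!EFinB opprD addrACA subrr addr0.
Qed.

Lemma integral_shift (f : R -> \bar R) (h : R) : measurable_fun [set: R] f ->
  (\int[mu]_x f (x - h)%R = \int[mu]_x f x)%E.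
Proof.
move=> mf.
have ge0 (g : R -> \bar R) : measurable_fun [set: R] g -> (forall x, 0 <= g x)%E ->
    (\int[mu]_x g (x - h)%R = \int[mu]_x g x)%E.
  move=> mg g0.
  have := @ge0_integral_pushforward _ _ (measurableTypeR R) (measurableTypeR R) R _
    (measurable_shift h) mu setT g measurableT mg (fun x _ => g0 x).
  rewrite preimage_setT => <-.
  apply: eq_measure_integral; first exact: measurable_shift.
  by move=> ms A mA _; exact: (lebesgue_measure_shift h mA).
rewrite integralE [RHS]integralE; congr (_ - _)%E.
  under eq_integral do rewrite funeposE -(funeposE f).
  by apply: (ge0 (f^\+)%E); [exact: measurable_funepos|move=> x; exact: funepos_ge0].
under eq_integral do rewrite funenegE -(funenegE f).
by apply: (ge0 (f^\-)%E); [exact: measurable_funeneg|move=> x; exact: funeneg_ge0].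
Qed.

Lemma Rintegral_shift (f : R -> R) (h : R) : measurable_fun setT f ->
  \int[mu]_x f (x - h) = \int[mu]_x f x.
Proof.
move=> mf; rewrite /Rintegral; congr fine.
by rewrite -(integral_shift (f := EFin \o f) h)//; exact/measurable_EFinP.
Qed.

End Translation.

Section OpenFTC.
Context {R : realType}.
Local Notation mu := (@lebesgue_measure R).

(** Serves integrands unbounded at an endpoint, such as powers with negative exponent. The interval
    is exhausted by compact ones, where the usual theorem applies; monotone convergence and
    continuity of F up to the ends give the limit. *)
Lemma ge0_integral_oo_FTC (f F : R -> R) a b : a < b ->
  {in `]a, b[, forall x, 0 <= f x} ->
  {in `]a, b[, continuous f} ->
  (forall x, x \in `]a, b[ -> is_derive x 1 F (f x)) ->
  {within `[a, b], continuous F} ->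
  (\int[mu]_(x in `]a, b[) (f x)%:E = (F b - F a)%:E)%E.
Proof.
move=> ab f0 cf dF cF.
(* The denominator is at least 3, so that the interval shrunk on both sides is never empty. *)
pose e n := (b - a) / n.+3%:R.
have e0 n : 0 < e n by rewrite divr_gt0// subr_gt0.
have e2 n : e n < (b - a) / 2.
  by rewrite ltr_pM2l ?subr_gt0// ltf_pV2 ?posrE// ltr_nat.
pose E n := `[a + e n, b - e n]%classic.
have sE n x : E n x -> x \in `]a, b[.
  rewrite /E /= !in_itv/= => /andP[h1 h2]; apply/andP; split.
    by rewrite (lt_le_trans _ h1)// ltrDl.
  by rewrite (le_lt_trans h2)// ltrBlDr ltrDl.
have UE : \bigcup_n E n = `]a, b[%classic.
  apply/seteqP; split=> [x [n _ /sE]//|x /=]; rewrite in_itv/= => /andP[ax xb].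
  have m0 : 0 < Num.min (x - a) (b - x) by rewrite lt_min !subr_gt0 ax.
  have m1 : 0 < Num.min (x - a) (b - x) / (b - a) by rewrite divr_gt0// subr_gt0.
  have [N _ /(_ N (leqnn _))/= HN] := near_infty_natSinv_lt (PosNum m1).
  exists N => //; rewrite /E /= in_itv/=.
  have : e N <= Num.min (x - a) (b - x).
    rewrite /e mulrC -ler_pdivlMr ?subr_gt0// (le_trans _ (ltW HN))//.
    by rewrite lef_pV2 ?posrE// ler_nat; do 2 apply: leqW.
  by rewrite le_min => /andP[]; rewrite lerBrDl => -> ; lra.
have EFTC n : (\int[mu]_(x in E n) (f x)%:E = (F (b - e n))%:E - (F (a + e n))%:E)%E.
  have ab' : a + e n < b - e n by have := e2 n; lra.
  have der x : x \in `]a + e n, b - e n[ -> is_derive x 1 F (f x).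
    by move=> xE; apply: dF; apply: (sE n); rewrite /E /=; exact: subset_itv_oo_cc.
  apply: continuous_FTC2 => //.
  - by apply: continuous_in_subspaceT => x /set_mem/sE xE; exact: cf.
  - have cFe x : x \in `]a, b[ -> {for x, continuous F}.
      by move=> /dF h; apply/differentiable_continuous/derivable1_diffP; exact: ex_derive.
    split.
    + by move=> x /der h; exact: ex_derive.
    + apply: cvg_at_right_filter; apply: cFe; apply: (sE n).
      by rewrite /E/= in_itv/= lexx ltW.
    + apply: cvg_at_left_filter; apply: cFe; apply: (sE n).
      by rewrite /E/= in_itv/= lexx ltW.
  - by move=> x /der h; rewrite derive1E derive_val.
have e_cvg : e n @[n --> \oo] --> 0.
  rewrite -(mulr0 (b - a)); apply: cvgMr.
  apply/cvgrPdist_lt => d d0; have [N _ HN] := near_infty_natSinv_lt (PosNum d0).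
  near=> n; rewrite sub0r normrN ger0_norm ?invr_ge0//.
  apply: le_lt_trans (HN n _); last by near: n; exists N.
  by rewrite lef_pV2 ?posrE// ler_nat; do 2 apply: leqW.
have L1 : (\int[mu]_(x in E n) (f x)%:E)%E @[n --> \oo] --> (\int[mu]_(x in `]a, b[) (f x)%:E)%E.
  rewrite -UE; apply: ge0_nondecreasing_set_cvg_integral.
  - apply/nondecreasing_seqP => n; rewrite subsetEset => x; rewrite /E /= !in_itv/=.
    have : e n.+1 <= e n by rewrite ler_pM2l ?subr_gt0// lef_pV2 ?posrE// ler_nat.
    by move=> h /andP[h1 h2]; apply/andP; split; lra.
  - by move=> n; exact: measurable_itv.
  - move=> n; apply/measurable_EFinP; apply: (@measurable_funS _ _ _ _ `]a, b[%classic) => //.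
      by move=> x /sE.
    by apply: open_continuous_measurable_fun => // x /set_mem; exact: cf.
  - by move=> n x /sE xE; rewrite lee_fin f0.
have /(continuous_within_itvP _ ab)[_ ca cb] := cF.
have La : F (a + e n) @[n --> \oo] --> F a.
  move/cvg_at_rightP : ca; apply; split; first by move=> n; rewrite ltrDl.
  by rewrite -[X in _ --> X]addr0; apply: cvgD => //; exact: cvg_cst.
have Lb : F (b - e n) @[n --> \oo] --> F b.
  move/cvg_at_leftP : cb; apply; split; first by move=> n; rewrite ltrBlDr ltrDl.
  by rewrite -[X in _ --> X]subr0; apply: cvgB => //; exact: cvg_cst.
have L2 : (\int[mu]_(x in E n) (f x)%:E)%E @[n --> \oo] --> (F b - F a)%:E.
  under eq_fun do rewrite EFTC -EFinB.
  by apply: cvg_EFin; [exact: nearW|apply: cvgB].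
exact: cvg_unique _ L1 L2.
Unshelve. all: end_near. Qed.

End OpenFTC.

Section KernelFubini.
Context {R : realType}.
Local Notation mu := (@lebesgue_measure R).
Variables (K : R -> R -> R) (Phi g : R -> R).
Hypothesis mK : measurable_fun [set: R * R] (fun p : R * R => K p.1 p.2).
Hypothesis K0 : forall t s, 0 <= K t s.
Hypothesis KPhi : forall s, (\int[mu]_t (K t s)%:E = (Phi s)%:E)%E.
Hypothesis mg : measurable_fun [set: R] g.
Hypothesis iPhig : (\int[mu]_s (Phi s * `|g s|)%:E < +oo)%E.

Let f (p : R * R) := K p.1 p.2 * g p.2.

Let mf : measurable_fun [set: R * R] (EFin \o f).
Proof.
apply/measurable_EFinP; apply: measurable_funM => //.
exact: measurableT_comp.
Qed.

Let mPhi : measurable_fun [set: R] Phi.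
Proof.
apply/measurable_EFinP; rewrite (_ : EFin \o Phi = fun s => \int[mu]_t (K t s)%:E)%E; last first.
  by apply/funext => s; rewrite KPhi.
apply: (@measurable_fun_fubini_tonelli_G _ _ (measurableTypeR R) (measurableTypeR R) R mu
    (fun p => (K p.1 p.2)%:E)) => //.
  exact/measurable_EFinP.
by move=> p; rewrite lee_fin.
Qed.

Let mKs s : measurable_fun [set: R] (K ^~ s).
Proof. exact: (measurableT_comp mK (measurable_pair2 s)). Qed.

Let KI s : mu.-integrable setT (EFin \o (K ^~ s)).
Proof.
apply/integrableP; split; first by apply/measurable_EFinP; exact: (mKs s).
under eq_integral do rewrite /= ger0_norm//.
by rewrite KPhi ltry.
Qed.

(** By Tonelli the integral of K(t, s) |g(s)| over the plane is that of Phi |g|, finite by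
    assumption. *)
Let If : (mu \x mu)%E.-integrable setT (EFin \o f).
Proof.
apply/integrable21ltyP => //; apply: le_lt_trans iPhig.
apply: ge0_le_integral => //.
- by move=> s _; exact: integral_ge0.
- apply: (@measurable_fun_fubini_tonelli_G _ _ (measurableTypeR R) (measurableTypeR R) R mu
    (abse \o (EFin \o f))) => //.
    exact: measurableT_comp.
  by move=> p; exact: abse_ge0.
- by apply/measurable_EFinP; apply: measurable_funM => //; exact: measurableT_comp.
- move=> s _; rewrite /f /=.
  under eq_integral do rewrite normrM ger0_norm// EFinM.
  by rewrite ge0_integralZr ?KPhi//;
    [by apply/measurable_EFinP; exact: (mKs s)|move=> t _; rewrite lee_fin].
Qed.

Lemma kernel_integrable :
  {ae mu, forall t, mu.-integrable setT (fun s => (K t s * g s)%:E)}.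
Proof. exact: (ae_integrable1 If). Qed.

Lemma kernel_fubini :
  \int[mu]_t \int[mu]_s (K t s * g s) = \int[mu]_s (Phi s * g s).
Proof.
transitivity (fine (\int[mu]_t \int[mu]_s ((K t s * g s)%:E))%E).
  (* For t in a null set the inner integral may fail to be finite, and [fine] would alter it
     there. *)
  rewrite /Rintegral; congr fine; apply: ae_eq_integral_nomeas.
  apply: filterS kernel_integrable; first exact: (ae_filter_ringOfSetsType mu).
  move=> t h _; rewrite fineK//.
  exact: integrable_fin_num h.
rewrite (Fubini If) /Rintegral; congr fine; apply: eq_integral => s _.
rewrite /f /=; under eq_integral do rewrite EFinM.
by rewrite (@integralZr _ _ _ mu _ measurableT _ (KI s))/= KPhi.
Qed.

End KernelFubini.

(** * Integrals of vector-valued functions *)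

Section FiniteRange.
Context {R : realType}.
Local Notation mu := (@lebesgue_measure R).

(** Simple functions into an arbitrary type: this lets them be paired and composed with any map,
    without measurability conditions on the map. *)
Definition fin_meas (D : set R) {Y : Type} (f : R -> Y) : Prop :=
  finite_set (f @` D) /\ forall y, measurable (D `&` f @^-1` [set y]).

Lemma fin_meas_preimage D Y (f : R -> Y) (B : set Y) :
  fin_meas D f -> measurable (D `&` f @^-1` B).
Proof.
move=> [ff mf].
rewrite (_ : _ `&` _ = \bigcup_(y in f @` D `&` B) (D `&` f @^-1` [set y])).
  apply: fin_bigcup_measurable => //.
  by apply: sub_finite_set ff => y [].
apply/seteqP; split=> [x [Dx Bx]|x [y [_ By] [Dx /= fx]]].
  by exists (f x) => //; split=> //; exists x.
by split=> //=; rewrite fx.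
Qed.

Lemma fin_meas_comp D Y Z (f : R -> Y) (h : Y -> Z) :
  fin_meas D f -> fin_meas D (h \o f).
Proof.
move=> mf; split; first by rewrite -image_comp; exact: finite_image mf.1.
by move=> z; exact: (fin_meas_preimage (h @^-1` [set z]) mf).
Qed.

Lemma fin_meas_pair D Y Z (f : R -> Y) (g : R -> Z) :
  fin_meas D f -> fin_meas D g -> fin_meas D (fun x => (f x, g x)).
Proof.
move=> mf mg; split.
  apply: sub_finite_set (finite_setX mf.1 mg.1) => _ [x Dx <-].
  by split; exists x.
move=> [y z]; rewrite (_ : _ `&` _ =
    (D `&` f @^-1` [set y]) `&` (D `&` g @^-1` [set z])).
  by apply: measurableI; [exact: mf.2|exact: mg.2].
by apply/seteqP; split=> [x [Dx [<- <-]]|x [[Dx /= <-] [_ /= <-]]].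
Qed.

Lemma fin_meas_measurable D (f : R -> R) : measurable D -> fin_meas D f ->
  measurable_fun D f.
Proof. by move=> mD mf _ B mB; exact: fin_meas_preimage. Qed.

Lemma fin_measS D E Y (f : R -> Y) : measurable E -> E `<=` D -> fin_meas D f ->
  fin_meas E f.
Proof.
move=> mE ED mf; split; first by apply: sub_finite_set mf.1; exact: image_subset.
move=> y; rewrite (_ : _ `&` _ = E `&` (D `&` f @^-1` [set y])); last first.
  by rewrite setIA (setIidl ED).
by apply: measurableI => //; exact: mf.2.
Qed.

Lemma fin_meas_patch D Y (f : R -> Y) (y0 : Y) : measurable D -> fin_meas D f ->
  fin_meas setT (fun t => if t \in D then f t else y0).
Proof.
move=> mD [ff mf]; split.
  apply: (@sub_finite_set _ _ ((f @` D) `|` [set y0])); last by rewrite finite_setU.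
  move=> _ [t _ <-]; case: ifPn => [/set_mem Dt|_]; last by right.
  by left; exists t.
move=> y; rewrite setTI.
rewrite (_ : _ @^-1` _ = (D `&` f @^-1` [set y]) `|` (~` D `&` [set t | y0 = y])).
  apply: measurableU => //; apply: measurableI; first exact: measurableC.
  have [<-|yy0] := pselect (y0 = y).
    by rewrite (_ : mkset _ = setT)//; apply/seteqP; split.
  by rewrite (_ : mkset _ = set0)//; apply/seteqP; split=> // t.
apply/seteqP; split=> t /=.
  by case: ifPn => [/set_mem Dt <-|/negP tD <-]; [left|right]; split=> // Dt;
    apply: tD; exact/mem_set.
by move=> [[Dt <-]|[Dt <-]]; [rewrite mem_set|rewrite memNset].
Qed.

Lemma fin_meas_cst D Y (y : Y) : measurable D -> fin_meas D (fun=> y).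
Proof.
move=> mD; split; first by apply: (@sub_finite_set _ _ [set y]) => // _ [x _ <-].
move=> z; have [->|yz] := pselect (z = y).
  by rewrite (_ : _ `&` _ = D)//; apply/seteqP; split=> [x []|x].
rewrite (_ : _ `&` _ = set0) //; apply/seteqP; split=> // x [_ /= yz'].
by apply: yz; rewrite yz'.
Qed.

Import HBNNSimple.

Lemma fin_meas_nnsfun (q : {nnsfun R >-> R}) : fin_meas setT q.
Proof.
split=> [|y]; first exact: fimfunP.
by rewrite setTI; exact: measurable_sfunP.
Qed.

End FiniteRange.

Section Nice.
Context {R : realType} {X : completeNormedModType R}.
Variable ip : {dot X for (@idfun R)}.
Hypothesis hip : induces_norm ip.
Local Notation mu := (@lebesgue_measure R).
Import HBNNSimple.

(** Everywhere limits of simple functions, with no exceptional set. They replace elements of L^2,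
    and continuous images of them are Borel functions on the line. *)
Definition nice (u : R -> X) : Prop :=
  exists s : nat -> R -> X,
    (forall n, fin_meas setT (s n)) /\ forall t, s n t @[n --> \oo] --> u t.

(** Both the function and its approximants are set to 0 on the exceptional null set and outside [D].
    Vanishing outside [D] later allows integration over the whole line. *)
Lemma nice_version (D : set R) (u : R -> X) : measurable D ->
  strongly_measurable D setT Num.norm u ->
  exists v, [/\ nice v, (forall t, ~ D t -> v t = 0) & u = v %[ae mu in D]].
Proof.
move=> mD [s [ss [N [mN N0 sN]]]].
pose E := D `\` N; have mE : measurable E by exact: measurableD.
pose v t := if t \in E then u t else 0.
exists v; split.
- exists (fun n t => if t \in E then s n t else 0); split.
    move=> n; apply: fin_meas_patch => //; apply: (@fin_measS _ D) => //.
      by move=> t [].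
    by have [] := ss n.
  move=> t; rewrite /v; have [/set_mem[Dt Nt]|_] := boolP (t \in E); last exact: cvg_cst.
  have /(_ Dt)[_ /cvgrPdist_lt h] : D t -> setT (u t) /\ `|s n t - u t| @[n --> \oo] --> (0 : R).
    by apply: contrapT => hn; apply: Nt; exact: sN.
  apply/cvgrPdist_lt => e /h; apply: filterS => n.
  by rewrite sub0r normrN normr_id distrC.
- move=> t Dt; rewrite /v ifF//; apply/negP => /set_mem[/Dt].
  by [].
- exists N; split=> // t /= h; apply: contrapT => Nt; apply: h => Dt.
  by rewrite /v mem_set.
Qed.

Lemma nice_measurable (u : R -> X) (phi : X -> R) : continuous phi -> nice u ->
  measurable_fun [set: R] (phi \o u).
Proof.
move=> cphi [s [ms su]].
apply: (@measurable_fun_cvg _ _ _ _ (fun n => phi \o s n)) => //.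
  by move=> n; apply: fin_meas_measurable => //; exact: fin_meas_comp.
by move=> t _; apply: continuous_cvg (su t); exact: cphi.
Qed.

Lemma nice_norm (u : R -> X) : nice u -> measurable_fun [set: R] (fun t => `|u t|).
Proof. by apply: nice_measurable; exact: norm_continuous. Qed.

Lemma nice_ip (u : R -> X) z : nice u -> measurable_fun [set: R] (fun t => ip (u t) z).
Proof. by apply: (@nice_measurable _ (ip^~ z)); exact: continuous_ipl. Qed.

Lemma nice_op2 (u v : R -> X) (h : X * X -> X) : continuous h -> nice u -> nice v ->
  nice (fun t => h (u t, v t)).
Proof.
move=> ch [s [ms su]] [s' [ms' su']].
exists (fun n t => h (s n t, s' n t)); split=> [n|t].
  exact: (fin_meas_comp h (fin_meas_pair (ms n) (ms' n))).
apply: continuous_cvg; first exact: ch.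
exact: cvg_pair (su t) (su' t).
Qed.

Lemma niceB (u v : R -> X) : nice u -> nice v -> nice (fun t => u t - v t).
Proof.
apply: (@nice_op2 u v (fun p => p.1 - p.2)) => p.
by apply: cvgB; [exact: cvg_fst|exact: cvg_snd].
Qed.

Lemma nice_fin (s : R -> X) : fin_meas setT s -> nice s.
Proof. by move=> ms; exists (fun=> s); split=> // t; exact: cvg_cst. Qed.

Lemma niceZ (k : R -> R) (u : R -> X) : measurable_fun [set: R] k ->
  (forall t, 0 <= k t) -> nice u -> nice (fun t => k t *: u t).
Proof.
move=> mk k0 [s [ms su]].
have mk' : measurable_fun [set: R] (EFin \o k) by exact/measurable_EFinP.
pose q := nnsfun_approx measurableT mk'.
exists (fun n t => q n t *: s n t); split=> [n|t].
  exact: (fin_meas_comp (fun p => p.1 *: p.2) (fin_meas_pair (fin_meas_nnsfun (q n)) (ms n))).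
apply: cvgZ (su t).
have /= := @cvg_nnsfun_approx _ _ _ _ measurableT _ mk' (fun x _ => k0 x) t I.
by move/fine_cvgP => [_].
Qed.

Lemma nice_strongly_measurable (D : set R) (u : R -> X) : measurable D -> nice u ->
  strongly_measurable D setT Num.norm u.
Proof.
move=> mD [s [ms su]]; exists s; split.
  by move=> n; have [? ?] := fin_measS mD (@subsetT _ D) (ms n); split.
apply: aeW => t _; split=> //; rewrite -(@normr0 _ X) -(subrr (u t)).
by apply: cvg_norm; apply: cvgB => //; exact: cvg_cst.
Qed.

Lemma ae_strongly_measurable (D : set R) (u v : R -> X) : u = v %[ae mu in D] ->
  strongly_measurable D setT Num.norm u -> strongly_measurable D setT Num.norm v.
Proof.
move=> uv [s [ms su]]; exists s; split=> //.
apply: filterS2 uv su; first exact: (ae_filter_ringOfSetsType mu).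
by move=> t h1 h2 Dt; have := h2 Dt; rewrite (h1 Dt).
Qed.

End Nice.

Section IntegrableReal.
Context {R : realType}.
Local Notation mu := (@lebesgue_measure R).
Variables (D : set R) (mD : measurable D).
Implicit Types f g : R -> R.

Lemma EFin_integrableZl (c : R) f : mu.-integrable D (fun t => (f t)%:E) ->
  mu.-integrable D (fun t => (c * f t)%:E).
Proof. exact: integrableZl. Qed.

Lemma EFin_integrableZr (c : R) f : mu.-integrable D (fun t => (f t)%:E) ->
  mu.-integrable D (fun t => (f t * c)%:E).
Proof. exact: integrableZr. Qed.

Lemma EFin_integrableD f g : mu.-integrable D (fun t => (f t)%:E) ->
  mu.-integrable D (fun t => (g t)%:E) -> mu.-integrable D (fun t => (f t + g t)%:E).
Proof. exact: integrableD. Qed.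

Lemma EFin_integrableB f g : mu.-integrable D (fun t => (f t)%:E) ->
  mu.-integrable D (fun t => (g t)%:E) -> mu.-integrable D (fun t => (f t - g t)%:E).
Proof. exact: integrableB. Qed.

Lemma lebesgue_eq_integrable (f g : R -> \bar R) : {in D, f =1 g} ->
  mu.-integrable D f -> mu.-integrable D g.
Proof. by move=> fg; apply: eq_integrable. Qed.

Lemma EFin_integralZl (c : R) f : mu.-integrable D (fun t => (f t)%:E) ->
  (\int[mu]_(t in D) (c%:E * (f t)%:E) = c%:E * \int[mu]_(t in D) (f t)%:E)%E.
Proof. by move=> h; rewrite integralZl. Qed.

Lemma le_norm_EFin_Rintegral f : mu.-integrable D (fun t => (f t)%:E) ->
  `|\int[mu]_(t in D) f t| <= \int[mu]_(t in D) `|f t|.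
Proof. by move=> h; apply: le_normr_Rintegral. Qed.

Lemma EFin_integrable_norm f : mu.-integrable D (fun t => (f t)%:E) ->
  mu.-integrable D (fun t => (`|f t|)%:E).
Proof. by move=> h; have := integrable_norm h. Qed.

End IntegrableReal.

Section WeakIntegral.
Context {R : realType} {X : completeNormedModType R}.
Variable ip : {dot X for (@idfun R)}.
Hypothesis hip : induces_norm ip.
Local Notation mu := (@lebesgue_measure R).
Import HBNNSimple.

(** The Pettis integral. It reduces identities and estimates for vector-valued integrals to scalar
    ones, and the Riesz theorem provides its existence. *)
Definition weak_integral (D : set R) (u : R -> X) (w : X) : Prop :=
  forall z, ip w z = \int[mu]_(t in D) ip (u t) z.

Variable D : set R.
Hypothesis mD : measurable D.

Definition norm_integrable (u : R -> X) : Prop :=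
  nice u /\ mu.-integrable D (fun t => `|u t|%:E).

Lemma norm_integrableE (u : R -> X) : nice u ->
  (\int[mu]_(t in D) `|u t|%:E < +oo)%E -> norm_integrable u.
Proof.
move=> nu iu; split=> //; apply/integrableP; split.
  by apply/measurable_EFinP; apply: measurable_funTS; exact: nice_norm.
by under eq_integral do rewrite abse_EFin normr_id.
Qed.

Lemma integrable_ip (u : R -> X) z : norm_integrable u ->
  mu.-integrable D (fun t => (ip (u t) z)%:E).
Proof.
move=> [nu iu]; apply: (@le_integrable _ _ _ mu D _ _ (fun t => (`|z| * `|u t|)%:E)) => //.
- by apply/measurable_EFinP; apply: measurable_funTS; exact: nice_ip.
- move=> t _; rewrite !abse_EFin lee_fin normrM !normr_id mulrC.
  exact: norm_ip.
- under eq_fun do rewrite EFinM.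
  exact: integrableZl.
Qed.

Lemma norm_integrableB (u v : R -> X) : norm_integrable u -> norm_integrable v ->
  norm_integrable (fun t => u t - v t).
Proof.
move=> [nu iu] [nv iv]; split; first exact: niceB.
apply: (@le_integrable _ _ _ mu D _ _ (fun t => (`|u t| + `|v t|)%:E)) => //.
- by apply/measurable_EFinP; apply: measurable_funTS; exact: nice_norm (niceB nu nv).
- move=> t _; rewrite !abse_EFin lee_fin normr_id (le_trans (ler_normB _ _))//.
  by rewrite ler_norm.
- under eq_fun do rewrite EFinD.
  exact: integrableD.
Qed.

(** Pairing with w itself gives |w|^2 = ∫ ip (u t) w <= |w| ∫ |u|. *)
Lemma le_norm_weak_integral (u : R -> X) (w : X) : norm_integrable u ->
  weak_integral D u w -> `|w| <= \int[mu]_(t in D) `|u t|.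
Proof.
move=> iu hw; have [->|w0] := eqVneq w 0.
  by rewrite normr0; apply: Rintegral_ge0.
have w0' : 0 < `|w| by rewrite normr_gt0.
rewrite -(ler_pM2r w0') -expr2 -(ipxx hip) hw.
have [_ iu'] := iu.
rewrite -RintegralZr//; apply: le_Rintegral => //.
- exact: integrable_ip.
- exact: (EFin_integrableZr mD `|w| iu').
- by move=> t _; exact: le_ip.
Qed.

Lemma weak_integralB (u v : R -> X) x y : norm_integrable u -> norm_integrable v ->
  weak_integral D u x -> weak_integral D v y ->
  weak_integral D (fun t => u t - v t) (x - y).
Proof.
move=> iu iv hx hy z; rewrite ipBl hx hy -RintegralB//; try exact: integrable_ip.
by apply: eq_Rintegral => t _; rewrite ipBl.
Qed.

Lemma weak_integral_exists (u : R -> X) : norm_integrable u ->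
  exists w, weak_integral D u w.
Proof.
move=> iu; have [_ iu'] := iu.
have [||w Hw] := @riesz _ _ ip hip (fun z => \int[mu]_(t in D) ip (u t) z)
    (\int[mu]_(t in D) `|u t|).
- move=> c x y; rewrite -RintegralZl//; last exact: integrable_ip.
  rewrite -RintegralD//; last exact: integrable_ip.
    by apply: eq_Rintegral => t _; rewrite ipDr ipZr.
  exact: (EFin_integrableZl mD c (integrable_ip x iu)).
- move=> z; rewrite (le_trans (le_norm_EFin_Rintegral mD (integrable_ip z iu)))//.
  rewrite -RintegralZr//; apply: le_Rintegral => //.
  + exact: EFin_integrable_norm (integrable_ip z iu).
  + exact: (EFin_integrableZr mD `|z| iu').
  + by move=> t _; exact: norm_ip.
by exists w => z; rewrite (ipC ip w) -Hw.
Qed.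

Hypothesis fD : (mu D < +oo)%E.

Lemma fin_meas_integral (Y : choiceType) (s : R -> Y) (h : Y -> R) : fin_meas D s ->
  mu.-integrable D (fun t => (h (s t))%:E) /\
  \int[mu]_(t in D) h (s t) = \sum_(y \in s @` D) fine (mu (D `&` s @^-1` [set y])) * h y.
Proof.
move=> [fs ms].
pose g y t : \bar R := ((h y)%:E * (\1_(D `&` s @^-1` [set y]) t)%:E)%E.
have hg t : D t -> (h (s t))%:E = (\sum_(y <- fset_set (s @` D)) g y t)%E.
  move=> Dt; have st : s t \in fset_set (s @` D).
    by rewrite in_fset_set// mem_set//; exists t.
  rewrite (bigD1_seq (s t))//= big1 ?adde0; last first.
    move=> y yst; rewrite /g indicE memNset ?mule0// => -[_ /= e].
    by rewrite e eqxx in yst.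
  by rewrite /g indicE mem_set ?mule1.
have indic_int y : mu.-integrable D (fun t => (\1_(D `&` s @^-1` [set y]) t)%:E).
  apply/integrableP; split; first by apply/measurable_EFinP; exact: measurable_indic (ms y).
  under eq_integral do rewrite abse_EFin ger0_norm//.
  rewrite integral_indic//; last exact: ms.
  apply: le_lt_trans fD; apply: le_measure.
  - by apply/mem_set; apply: measurableI => //; exact: ms.
  - exact/mem_set.
  - by move=> t [[]].
have ig y : mu.-integrable D (g y).
  by apply: integrableZl => //; exact: indic_int.
have E : (\int[mu]_(t in D) (h (s t))%:E =
    (\sum_(y <- fset_set (s @` D)) fine (mu (D `&` s @^-1` [set y])) * h y)%:E)%E.
  transitivity (\int[mu]_(t in D) (\sum_(y <- fset_set (s @` D)) g y t))%E.
    by apply: eq_integral => t /set_mem; exact: hg.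
  rewrite integral_sum// -sumEFin; apply: eq_bigr => y _.
  rewrite /g (EFin_integralZl mD _ (indic_int y)).
  rewrite integral_indic//; last exact: ms.
  rewrite setIAC setIid.
  have fK (m : \bar R) : m \is a fin_num -> ((h y)%:E * m = (fine m * h y)%:E)%E.
    by move=> mf; rewrite -{1}(fineK mf) -EFinM mulrC.
  apply: fK; rewrite ge0_fin_numE ?measure_ge0//.
  apply: le_lt_trans fD; apply: le_measure.
  - by apply/mem_set; exact: ms.
  - exact/mem_set.
  - by move=> t [].
split; last by rewrite /Rintegral E fsbig_finite.
apply: (lebesgue_eq_integrable mD (f := fun t => \sum_(y <- fset_set (s @` D)) g y t)%E).
  by move=> t /set_mem Dt; rewrite hg.
by apply: integrable_sum.
Qed.

Lemma simple_integral_weak (s : R -> X) : fin_meas D s ->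
  weak_integral D s (simple_integral D s).
Proof.
move=> ms z; have [_ ->] := fin_meas_integral (ip^~ z) ms.
rewrite /simple_integral !fsbig_finite//; try exact: ms.1.
elim/big_rec2 : _ => [|y a x _ <-]; first by rewrite ip0l.
by rewrite ipDl ipZl.
Qed.

Lemma norm_integrable_fin_meas (s : R -> X) : fin_meas setT s -> norm_integrable s.
Proof.
move=> ms; split; first exact: nice_fin.
exact: (fin_meas_integral (fun x => `|x|) (fin_measS mD (@subsetT _ D) ms)).1.
Qed.

(** The given approximants converge pointwise but need no integrable bound. Each is set to 0 where
    it exceeds twice a simple minorant of |u|; the result is bounded by 2 |u|, and dominated
    convergence applies with 3 |u|. *)
Lemma simple_approx (u : R -> X) : norm_integrable u -> exists s : nat -> R -> X,
  (forall n, fin_meas setT (s n)) /\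
  (\int[mu]_(t in D) (`|s n t - u t|)%:E)%E @[n --> \oo] --> 0%E.
Proof.
move=> [[s [ms su]] iu].
have nu : nice u by exists s.
have mnu : measurable_fun [set: R] (EFin \o (fun t => `|u t|)).
  by apply/measurable_EFinP; exact: nice_norm.
pose q := nnsfun_approx measurableT mnu.
have qu t : q n t @[n --> \oo] --> `|u t|.
  have /= := @cvg_nnsfun_approx _ _ _ _ measurableT _ mnu (fun x _ => normr_ge0 _) t I.
  by move/fine_cvgP => [_].
have qle n t : q n t <= `|u t|.
  rewrite -(cvg_lim _ (qu t))//; apply: nondecreasing_cvgn_le.
    by move=> i j ij; have /lefP := nd_nnsfun_approx measurableT mnu ij; apply.
  by apply/cvg_ex; exists `|u t|; exact: qu.
pose c (p : X * R) : X := if `|p.1| <= 2 * p.2 then p.1 else 0.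
pose r n t := c (s n t, q n t).
have mr n : fin_meas setT (r n).
  exact: (fin_meas_comp c (fin_meas_pair (ms n) (fin_meas_nnsfun (q n)))).
have rle n t : `|r n t| <= 2 * `|u t|.
  rewrite /r /c /=; case: ifPn => [/le_trans|_]; last by rewrite normr0 mulr_ge0.
  by apply; rewrite ler_pM2l.
have rcvg t : r n t @[n --> \oo] --> u t.
  have [u0|u0] := eqVneq (u t) 0.
    rewrite u0; apply/cvgrPdist_le => e e0; near=> n.
    by rewrite sub0r normrN (le_trans (rle n t))// u0 normr0 mulr0 ltW.
  have /cvgrPdist_lt su' := su t.
  (* Within this tolerance |s n t| <= 5/4 |u t| and 2 q n t >= 3/2 |u t|, so the truncation is
     eventually inactive at t. *)
  have u0' : 0 < `|u t| / 4 by rewrite divr_gt0// normr_gt0.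
  apply/cvgrPdist_lt => e e0; near=> n; rewrite /r /c /= ifT.
    by near: n; exact: su'.
  have h1 : `|u t - s n t| < `|u t| / 4 by near: n; exact: su'.
  have h2 : `| `|u t| - q n t| < `|u t| / 4.
    by near: n; move/cvgrPdist_lt : (qu t); exact.
  have h3 : `|s n t| <= `|u t| + `|u t - s n t|.
    by rewrite -[X in `|X| <= _](subKr (u t)) ler_normB.
  by move: h2; rewrite ltr_norml => /andP[]; lra.
exists r; split=> //.
have mru n : measurable_fun D (fun t => (`|r n t - u t|)%:E).
  apply/measurable_EFinP; apply: measurable_funTS.
  exact: nice_norm (niceB (nice_fin (mr n)) nu).
have h1 : {ae mu, forall t, D t -> (`|r n t - u t|)%:E @[n --> \oo] --> 0%E}.
  apply: aeW => t _; apply: cvg_EFin; first exact: nearW.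
  rewrite -[X in _ --> X](@normr0 _ X) -(subrr (u t)).
  by apply: cvg_norm; apply: cvgB => //; exact: cvg_cst.
have h2 : mu.-integrable D (fun t => (3 * `|u t|)%:E) by exact: EFin_integrableZl.
have h3 : {ae mu, forall t n, D t -> (`|(`|r n t - u t|)%:E| <= (3 * `|u t|)%:E)%E}.
  apply: aeW => t n _; rewrite abse_EFin lee_fin normr_id (le_trans (ler_normB _ _))//.
  by have := rle n t; lra.
have [_ + _] := @dominated_convergence _ _ R mu D mD (fun n t => (`|r n t - u t|)%:E)
  (fun=> 0%E) _ mru (measurable_cst _) h1 h2 h3.
move=> H; rewrite (_ : (fun n => _) =
  [sequence (\int[mu]_(x in D) `|(`|r n x - u x|)%:E - 0%R|)%E]_n)//.
apply/funext => n; apply: eq_integral => t _.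
by rewrite /= subr0 normr_id.
Unshelve. all: end_near. Qed.

Lemma has_bochner_weak (u f : R -> X) w : norm_integrable u -> f = u %[ae mu in D] ->
  has_bochner_integral D f w -> weak_integral D u w.
Proof.
move=> iu fu [_ [s [ss sf sw]]] z.
have [nu iu'] := iu.
have ms n : fin_meas D (s n) by have [] := ss n.
have sipw : ip (simple_integral D (s n)) z @[n --> \oo] --> ip w z.
  exact: (cvg_comp _ _ sw (continuous_ipl hip (z:=z) (x:=w))).
suff: ip (simple_integral D (s n)) z @[n --> \oo] --> \int[mu]_(t in D) ip (u t) z.
  by move=> h; exact: cvg_unique sipw h.
have su : (\int[mu]_(t in D) (`|s n t - u t|)%:E)%E @[n --> \oo] --> 0%E.
  rewrite (_ : (fun n => _) = (fun n => \int[mu]_(t in D) (`|s n t - f t|)%:E)%E)//.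
  apply/funext => n; apply: ae_eq_integral_nomeas.
  apply: filterS fu; first exact: (ae_filter_ringOfSetsType mu).
  by move=> t h /h ->.
apply/cvgrPdist_le => e e0.
have z0 : 0 < `|z| + 1 by rewrite ltr_wpDl.
have e1 : 0 < e / (`|z| + 1) by rewrite divr_gt0.
have /fine_cvgP[fsu /cvgrPdist_le/(_ _ e1)] := su.
apply: filterS2 fsu => n fn; rewrite sub0r normrN => hn.
have [is_ip Es] := fin_meas_integral (ip^~ z) (ms n).
rewrite (simple_integral_weak (ms n)) -RintegralB//; last exact: integrable_ip.
(* The approximants are simple on [D] only; extended by 0 they become [nice] on the whole line. *)
pose r t := if t \in D then s n t else 0.
have nr : nice r by apply: nice_fin; exact: fin_meas_patch.
have rE t : D t -> s n t = r t by move=> Dt; rewrite /r mem_set.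
have ir : norm_integrable (fun t => r t - u t).
  apply: norm_integrableE; first exact: niceB.
  have -> : (\int[mu]_(t in D) (`|r t - u t|)%:E = \int[mu]_(t in D) (`|s n t - u t|)%:E)%E.
    by apply: eq_integral => t /set_mem/rE ->.
  by rewrite -ge0_fin_numE//; exact: integral_ge0.
have -> : \int[mu]_(t in D) (ip (u t) z - ip (s n t) z) = - \int[mu]_(t in D) ip (r t - u t) z.
  rewrite -mulN1r -RintegralZl//; last exact: integrable_ip.
  by apply: eq_Rintegral => t /set_mem/rE ->; rewrite ipBl mulN1r opprB.
rewrite normrN.
rewrite (le_trans (le_norm_EFin_Rintegral mD (integrable_ip z ir)))//.
have [_ ir'] := ir.
rewrite (@le_trans _ _ (\int[mu]_(t in D) (`|r t - u t| * `|z|)))//.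
  apply: le_Rintegral => //.
  - exact: EFin_integrable_norm (integrable_ip z ir).
  - exact: (EFin_integrableZr mD `|z| ir').
  - by move=> t _; exact: norm_ip.
rewrite RintegralZr//.
rewrite (@le_trans _ _ ((\int[mu]_(t in D) `|r t - u t|) * (`|z| + 1)))//.
  by apply: ler_wpM2l; rewrite ?lerDl//; apply: Rintegral_ge0.
rewrite -ler_pdivlMr// (le_trans _ hn)//.
have -> : \int[mu]_(t in D) `|r t - u t| = \int[mu]_(t in D) `|s n t - u t|.
  by apply: eq_Rintegral => t /set_mem/rE ->.
exact: ler_norm.
Qed.

(** It remains to see that a Bochner integral exists, so that the default value 0 is not what is
    chosen. The integrals of the simple approximants are Cauchy, since each lies within ∫ |s n - u|
    of the weak integral. *)
Lemma bochner_weak (u f : R -> X) : norm_integrable u -> f = u %[ae mu in D] ->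
  weak_integral D u (bochner_integral D f).
Proof.
move=> iu fu; have [nu iu'] := iu; apply: (has_bochner_weak iu fu).
have [s [ms su]] := simple_approx iu.
have msD n : fin_meas D (s n) := fin_measS mD (@subsetT _ D) (ms n).
have is_ n := norm_integrable_fin_meas (ms n).
have /fine_cvgP[fsu /cvgrPdist_le dsu] := su.
suff /cvg_ex[w sw] : cvg (simple_integral D (s n) @[n --> \oo]).
  apply: (@xgetPex _ 0 [set w | has_bochner_integral D f w]).
  exists w; split.
    apply: ae_strongly_measurable (nice_strongly_measurable mD nu).
    apply: filterS fu; first exact: (ae_filter_ringOfSetsType mu).
    by move=> t h /h.
  exists s; split=> // [n|]; first by have [] := msD n.
  rewrite (_ : (fun n => _) = (fun n => \int[mu]_(t in D) (`|s n t - u t|)%:E)%E)//.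
  apply/funext => n; apply: ae_eq_integral_nomeas.
  apply: filterS fu; first exact: (ae_filter_ringOfSetsType mu).
  by move=> t h /h ->.
apply: cauchy_seq_cvg => e e0.
have e2 : 0 < e / 2 by rewrite divr_gt0.
have [N _ HN] := dsu _ e2.
have key n : (N <= n)%N -> `|simple_integral D (s n) - xget 0 (weak_integral D u)| <= e / 2.
  move=> /HN /=; rewrite sub0r normrN => h.
  have hu : weak_integral D u (xget 0 (weak_integral D u)).
    exact: (@xgetPex _ 0 (weak_integral D u) (weak_integral_exists iu)).
  have := weak_integralB (is_ n) iu (simple_integral_weak (msD n)) hu.
  move/(le_norm_weak_integral (norm_integrableB (is_ n) iu)) => /le_trans; apply.
  by rewrite (le_trans _ h)// ler_norm.
exists N => i j Ni Nj.
rewrite -(subrKA (xget 0 (weak_integral D u))) (le_trans (ler_normD _ _))//.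
rewrite (distrC _ (simple_integral D (s j))) [leRHS](splitr e).
by apply: lerD; exact: key.
Qed.

End WeakIntegral.

(** * Fractional integrals at a maximum *)

Section PowerIntegrals.
Context {R : realType}.
Local Notation mu := (@lebesgue_measure R).
Implicit Types a b p x t : R.

Lemma is_derive_powR p a : 0 < a -> is_derive a 1 (@powR R ^~ p) (p * a `^ (p - 1)).
Proof.
move=> a0; have aoo : a \in `]0, +oo[ by rewrite in_itv/= a0.
by apply: DeriveDef; [exact: derivable_powR|rewrite -derive1E powR_derive1].
Qed.

Lemma is_derive_powRBl p t x : x < t ->
  is_derive x 1 (fun x => (t - x) `^ p) (- (p * (t - x) `^ (p - 1))).
Proof.
move=> xt; have h : 0 < t - x by rewrite subr_gt0.
have d1 := is_derive_powR p h.
have d2 : is_derive x 1 (fun x => t - x) (0 - 1) by apply: is_deriveB.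
have := @is_derive1_comp _ (@powR R ^~ p) (fun x => t - x) x _ _ d1 d2.
by rewrite sub0r mulrN1.
Qed.

Lemma is_derive_powRBr p s x : s < x ->
  is_derive x 1 (fun x => (x - s) `^ p) (p * (x - s) `^ (p - 1)).
Proof.
move=> sx; have h : 0 < x - s by rewrite subr_gt0.
have d1 := is_derive_powR p h.
have d2 : is_derive x 1 (fun x => x - s) (1 - 0) by apply: is_deriveB.
have := @is_derive1_comp _ (@powR R ^~ p) (fun x => x - s) x _ _ d1 d2.
by rewrite subr0 mulr1.
Qed.

Lemma is_derive_continuous (f : R -> R) x (df : R) : is_derive x 1 f df ->
  {for x, continuous f}.
Proof.
by move=> h; apply/differentiable_continuous/derivable1_diffP; exact: ex_derive.
Qed.

Lemma powRBl_cvg p t : 0 < p -> (t - x) `^ p @[x --> t^'-] --> (t - t) `^ p.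
Proof.
move=> p0; rewrite subrr powR0 ?gt_eqF//.
apply/cvg_at_leftP => u [ut uc].
have /cvg_at_rightP := @powR_cvg0 R p p0.
apply; split; first by move=> n; rewrite subr_gt0.
by rewrite -(subrr t); apply: cvgB => //; exact: cvg_cst.
Qed.

Lemma powRBr_cvg p s : 0 < p -> (x - s) `^ p @[x --> s^'+] --> (s - s) `^ p.
Proof.
move=> p0; rewrite subrr powR0 ?gt_eqF//.
apply/cvg_at_rightP => u [ut uc].
have /cvg_at_rightP := @powR_cvg0 R p p0.
apply; split; first by move=> n; rewrite subr_gt0.
by rewrite -(subrr s); apply: cvgB => //; exact: cvg_cst.
Qed.

Lemma within_powRBl p a b t : a < b -> b <= t -> (b < t) || (0 < p) ->
  {within `[a, b], continuous (fun x => (t - x) `^ p)}.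
Proof.
move=> ab bt hp; apply/continuous_within_itvP => //; split.
- move=> x; rewrite in_itv/= => /andP[ax xb].
  exact: is_derive_continuous (is_derive_powRBl p (lt_le_trans xb bt)).
- apply: cvg_at_right_filter.
  exact: is_derive_continuous (is_derive_powRBl p (lt_le_trans ab bt)).
- have [bt'|tb] := ltP b t.
    apply: cvg_at_left_filter.
    exact: is_derive_continuous (is_derive_powRBl p bt').
  have {}bt : b = t by apply/le_anti; rewrite bt.
  by move: hp; rewrite bt ltxx/= => p0; exact: powRBl_cvg.
Qed.

Lemma within_powRBr p a b s : a < b -> s <= a -> (s < a) || (0 < p) ->
  {within `[a, b], continuous (fun x => (x - s) `^ p)}.
Proof.
move=> ab sa hp; apply/continuous_within_itvP => //; split.
- move=> x; rewrite in_itv/= => /andP[ax xb].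
  exact: is_derive_continuous (is_derive_powRBr p (le_lt_trans sa ax)).
- have [sa'|as_] := ltP s a.
    apply: cvg_at_right_filter.
    exact: is_derive_continuous (is_derive_powRBr p sa').
  have {}sa : s = a by apply/le_anti; rewrite sa.
  by move: hp; rewrite -sa ltxx/= => p0; exact: powRBr_cvg.
- apply: cvg_at_left_filter.
  exact: is_derive_continuous (is_derive_powRBr p (le_lt_trans sa ab)).
Qed.

Lemma integral_powRBl p a b t : p != 0 -> a < b -> b <= t -> (b < t) || (0 < p) ->
  (\int[mu]_(x in `]a, b[) ((t - x) `^ (p - 1))%:E =
   (((t - a) `^ p - (t - b) `^ p) / p)%:E)%E.
Proof.
move=> p0 ab bt hp.
pose F x := - (p^-1) * (t - x) `^ p.
have -> : ((t - a) `^ p - (t - b) `^ p) / p = F b - F a by rewrite /F; ring.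
apply: ge0_integral_oo_FTC => //.
- by move=> x _; exact: powR_ge0.
- move=> x; rewrite in_itv/= => /andP[ax xb].
  exact: is_derive_continuous (is_derive_powRBl _ (lt_le_trans xb bt)).
- move=> x; rewrite in_itv/= => /andP[ax xb].
  have h := is_derive_powRBl p (lt_le_trans xb bt).
  rewrite [X in is_derive _ _ _ X](_ : _ = - (p^-1) * - (p * (t - x) `^ (p - 1))).
    exact: is_deriveZ.
  by field.
- by move=> x; apply: cvgMr; exact: within_powRBl.
Qed.

Lemma integral_powRBr p a b : 0 < p -> a < b ->
  (\int[mu]_(x in `]a, b[) ((x - a) `^ (p - 1))%:E = ((b - a) `^ p / p)%:E)%E.
Proof.
move=> p0 ab; have p0' : p != 0 by rewrite gt_eqF.
pose F x := p^-1 * (x - a) `^ p.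
have -> : (b - a) `^ p / p = F b - F a by rewrite /F subrr powR0//; field.
apply: ge0_integral_oo_FTC => //.
- by move=> x _; exact: powR_ge0.
- move=> x; rewrite in_itv/= => /andP[ax xb].
  exact: is_derive_continuous (is_derive_powRBr _ ax).
- move=> x; rewrite in_itv/= => /andP[ax xb].
  have h := is_derive_powRBr p ax.
  rewrite [X in is_derive _ _ _ X](_ : _ = (p^-1) * (p * (x - a) `^ (p - 1))).
    exact: is_deriveZ.
  by field.
- by move=> x; apply: cvgMr; apply: within_powRBr => //; rewrite p0 orbT.
Qed.

(* The integrand is the derivative of [((x - s) / (t - x)) `^ p] up to the factor
   [p * (t - s)]. *)
Lemma integral_powR_beta p s b t : 0 < p -> s < b -> b < t ->
  (\int[mu]_(x in `]s, b[) (p * (t - x) `^ (- p - 1) * (x - s) `^ (p - 1))%:E =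
   ((t - b) `^ (- p) * (b - s) `^ p / (t - s))%:E)%E.
Proof.
move=> p0 sb bt; have p0' : p != 0 by rewrite gt_eqF.
have st : 0 < t - s by rewrite subr_gt0 (lt_trans sb).
pose F x := (t - s)^-1 * ((t - x) `^ (- p) * (x - s) `^ p).
have -> : (t - b) `^ (- p) * (b - s) `^ p / (t - s) = F b - F s.
  by rewrite /F subrr powR0//; field; rewrite gt_eqF.
apply: ge0_integral_oo_FTC => //.
- by move=> x _; rewrite !mulr_ge0 ?powR_ge0// ltW.
- move=> x; rewrite in_itv/= => /andP[sx xb].
  apply: cvgM; first apply: cvgM; first exact: cvg_cst.
    exact: is_derive_continuous (is_derive_powRBl _ (lt_trans xb bt)).
  exact: is_derive_continuous (is_derive_powRBr _ sx).
- move=> x; rewrite in_itv/= => /andP[sx xb].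
  have xt := lt_trans xb bt.
  have h1 := is_derive_powRBl (- p) xt.
  have h2 := is_derive_powRBr p sx.
  have h := is_deriveZ (t - s)^-1 (is_deriveM h1 h2).
  apply: is_derive_eq h _.
  have E1 : (t - x) `^ (- p) = (t - x) * (t - x) `^ (- p - 1).
    rewrite -{2}[t - x]powRr1 ?subr_ge0 ?(ltW xt)// -powRD; last first.
      by apply/implyP => _; rewrite subr_eq0 gt_eqF.
    by congr powR; ring.
  have E2 : (x - s) `^ p = (x - s) * (x - s) `^ (p - 1).
    by rewrite mulr_powRB1// subr_ge0 ltW.
  rewrite E1 E2.
  rewrite /GRing.scale/=; field.
  by rewrite gt_eqF.
- move=> x; apply: cvgMr; apply: cvgM.
    by apply: within_powRBl => //; rewrite ?bt// ltW.
  by apply: within_powRBr => //; rewrite p0 orbT.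
Qed.

End PowerIntegrals.

Section TriangleFubini.
Context {R : realType}.
Local Notation mu := (@lebesgue_measure R).
Variables (tau M : R) (k : R -> R -> R) (Phi g : R -> R).
Hypothesis mk : measurable_fun [set: R * R] (fun p : R * R => k p.1 p.2).
Hypothesis k0 : forall t s, 0 < s -> s < t -> t < tau -> 0 <= k t s.
Hypothesis kPhi : forall s, 0 < s -> s < tau ->
  (\int[mu]_(t in `]s, tau[) (k t s)%:E = (Phi s)%:E)%E.
Hypothesis PhiM : forall s, 0 < s -> s < tau -> Phi s <= M.
Hypothesis mg : measurable_fun [set: R] g.
Hypothesis ig : mu.-integrable `]0, tau[ (fun s => (g s)%:E).

Let K t s := if [&& 0 < s, s < t & t < tau] then k t s else 0.
Let Psi s := if (0 < s) && (s < tau) then Phi s else 0.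

Let mK : measurable_fun [set: R * R] (fun p : R * R => K p.1 p.2).
Proof.
apply: measurable_fun_ifT => //.
by apply: measurable_and; [|apply: measurable_and]; apply: measurable_fun_ltr.
Qed.

Let K0 t s : 0 <= K t s.
Proof. by rewrite /K; case: ifPn => // /and3P[? ? ?]; exact: k0. Qed.

Let KPsi s : (\int[mu]_t (K t s)%:E = (Psi s)%:E)%E.
Proof.
rewrite /Psi; case: ifPn => [/andP[s0 st]|h].
  rewrite -kPhi// [RHS]integral_mkcond; apply: eq_integral => t _.
  rewrite patchE /K s0 /=; case: ifPn => [h|h].
    by rewrite mem_set//= in_itv/=.
  by rewrite memNset//= in_itv/=; exact/negP.
rewrite integral0_eq// => t _; rewrite /K ifF//; apply/negbTE; apply: contra h.
by case/and3P => -> /lt_trans /[apply] ->.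
Qed.

Let iPsig : (\int[mu]_s (Psi s * `|g s|)%:E < +oo)%E.
Proof.
have Psi0 s : 0 <= Psi s.
  by rewrite -lee_fin -KPsi; apply: integral_ge0 => t _; rewrite lee_fin.
have iM : mu.-integrable `]0, tau[ (fun s => (`|M| * `|g s|)%:E).
  by apply: EFin_integrableZl => //; exact: EFin_integrable_norm.
have /integrableP[_] := iM; apply: le_lt_trans.
rewrite [leRHS]integral_mkcond.
apply: ae_le_ge0_integralT.
- by move=> s; rewrite lee_fin mulr_ge0.
- by move=> s; rewrite erestrict_ge0.
- apply: aeW => s; rewrite patchE /Psi.
  case: ifPn => [/andP[s0 st]|h]; last first.
    by rewrite mul0r; case: ifPn => _ //; exact: abse_ge0.
  rewrite mem_set/= ?in_itv/= ?s0// lee_fin normrM !normr_id ler_wpM2r//.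
  by rewrite (le_trans _ (ler_norm M))//; exact: PhiM.
Qed.

Let Kg_mkcond t : 0 < t -> t < tau ->
  (fun s => K t s * g s) = (fun s => k t s * g s) \_ `]0, t[.
Proof.
move=> t0 tt; apply/funext => s; rewrite patchE /K tt andbT.
case: ifPn => [h|h]; first by rewrite mem_set.
by rewrite memNset ?mul0r//=; rewrite in_itv/=; exact/negP.
Qed.

(** At an individual t the singular convolution with an integrable g may diverge; the exceptional t
    form a null set. This makes [frac_integral] a genuine integral almost everywhere. *)
Lemma triangle_integrable : {ae mu, forall t, 0 < t -> t < tau ->
  mu.-integrable `]0, t[ (fun s => (k t s * g s)%:E)}.
Proof.
have := kernel_integrable mK K0 KPsi mg iPsig.
apply: filterS; first exact: (ae_filter_ringOfSetsType mu).
move=> t + t0 tt.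
have -> : (fun s => (K t s * g s)%:E) = (fun s => (k t s * g s)%:E) \_ `]0, t[.
  apply/funext => s; have := congr1 (fun f => f s) (Kg_mkcond t0 tt).
  by rewrite !patchE; case: ifPn => _ ->.
by move=> h; apply/integrable_mkcond.
Qed.

Lemma triangle_fubini :
  \int[mu]_(t in `]0, tau[) \int[mu]_(s in `]0, t[) (k t s * g s) =
  \int[mu]_(s in `]0, tau[) (Phi s * g s).
Proof.
transitivity (\int[mu]_t \int[mu]_s (K t s * g s)).
  rewrite Rintegral_mkcond; apply: eq_Rintegral => t _; rewrite patchE.
  case: ifPn => [/set_mem/=|/negP tE].
    rewrite in_itv/= => /andP[t0 tt].
    by rewrite Kg_mkcond// -Rintegral_mkcond.
  apply/esym; rewrite /Rintegral integral0_eq// => s _; rewrite /K ifF ?mul0r//.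
  apply/negP => /and3P[s0 st tt]; apply: tE.
  by apply/mem_set; rewrite /= in_itv/= tt (lt_trans s0).
rewrite (kernel_fubini mK K0 KPsi mg iPsig) [RHS]Rintegral_mkcond.
apply: eq_Rintegral => s _; rewrite patchE /Psi.
case: ifPn => [h|h]; first by rewrite mem_set//= in_itv.
by rewrite memNset ?mul0r//= in_itv/=; exact/negP.
Qed.

End TriangleFubini.

Section KernelBounds.
Context {R : realType}.
Local Notation mu := (@lebesgue_measure R).

Lemma EFin_integrable_bounded (D : set R) (k g : R -> R) M : measurable D ->
  mu.-integrable D (fun s => (k s)%:E) -> measurable_fun [set: R] g ->
  (forall s, D s -> `|g s| <= M) -> mu.-integrable D (fun s => (k s * g s)%:E).
Proof.
move=> mD ik mg gM.
have mk : measurable_fun D k by have /integrableP[/measurable_EFinP] := ik.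
apply: (@le_integrable _ _ _ mu D _ _ (fun s => (`|k s| * M)%:E)) => //.
- apply/measurable_EFinP; apply: measurable_funM => //; exact: measurable_funTS.
- move=> s Ds; rewrite !abse_EFin lee_fin !normrM normr_id ler_wpM2l//.
  by rewrite (le_trans (gM _ Ds))// ler_norm.
- by apply: EFin_integrableZr => //; exact: EFin_integrable_norm.
Qed.

Lemma integrable_powRBl (p a b t : R) : p != 0 -> b <= t -> (b < t) || (0 < p) ->
  mu.-integrable `]a, b[ (fun s => ((t - s) `^ (p - 1))%:E).
Proof.
move=> p0 bt hp; have [ab|ba] := ltP a b; last first.
  by rewrite set_itv_ge ?bnd_simp -?leNgt//; exact: integrable_set0.
apply/integrableP; split.
  apply/measurable_EFinP; apply: measurable_funTS.
  apply: (measurableT_comp (measurable_powR _)); exact: measurable_funB.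
under eq_integral do rewrite abse_EFin ger0_norm ?powR_ge0//.
by rewrite integral_powRBl// ltry.
Qed.

Lemma integrable_powRBr (p a b : R) : 0 < p ->
  mu.-integrable `]a, b[ (fun s => ((s - a) `^ (p - 1))%:E).
Proof.
move=> p0; have [ab|ba] := ltP a b; last first.
  by rewrite set_itv_ge ?bnd_simp -?leNgt//; exact: integrable_set0.
apply/integrableP; split.
  apply/measurable_EFinP; apply: measurable_funTS.
  apply: (measurableT_comp (measurable_powR _)); exact: measurable_funB.
under eq_integral do rewrite abse_EFin ger0_norm ?powR_ge0//.
by rewrite integral_powRBr// ltry.
Qed.

Lemma Rintegral_powRBl (p a b t : R) : p != 0 -> a < b -> b <= t -> (b < t) || (0 < p) ->
  \int[mu]_(x in `]a, b[) (t - x) `^ (p - 1) = ((t - a) `^ p - (t - b) `^ p) / p.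
Proof. by move=> *; rewrite /Rintegral integral_powRBl. Qed.

Lemma continuous_integrable_itv (h : R -> R) a b : continuous h ->
  mu.-integrable `]a, b[ (fun s => (h s)%:E).
Proof.
move=> ch; apply: (@integrableS _ _ _ mu `[a, b]) => //.
  exact: subset_itv_oo_cc.
apply: continuous_compact_integrable; first exact: segment_compact.
exact: continuous_subspaceT.
Qed.

Lemma continuous_bounded_itv (h : R -> R) a b : a <= b -> continuous h ->
  exists2 M, 0 <= M & forall s, a <= s -> s <= b -> `|h s| <= M.
Proof.
move=> ab ch.
have [c _ Hc] := @EVT_max R (fun s => `|h s|) a b ab
   (continuous_subspaceT (fun x => cvg_norm (ch x))).
exists `|h c| => // s sa sb; apply: Hc.
by rewrite in_itv/= sa.
Qed.

Lemma Rintegral_split (h : R -> R) a b c : a < b -> b < c ->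
  mu.-integrable `]a, c[ (fun s => (h s)%:E) ->
  \int[mu]_(s in `]a, c[) h s = \int[mu]_(s in `]a, b[) h s + \int[mu]_(s in `]b, c[) h s.
Proof.
move=> ab bc ih.
have e : `]a, c[%classic = `]a, b] `|` `]b, c[ :> set R.
  by rewrite -itv_bndbnd_setU// bnd_simp ltW.
have i1 : mu.-integrable `]a, b[ (fun s => (h s)%:E).
  by apply: (integrableS _ _ _ ih) => //; apply: subset_itvl; rewrite bnd_simp ltW.
rewrite e Rintegral_setU//.
- by rewrite -Rintegral_itv_bndo_bndc.
- by rewrite -e.
- apply/disj_setPS => x [] /=; rewrite !in_itv/= => /andP[_ xb] /andP[bx _].
  by have := le_lt_trans xb bx; rewrite ltxx.
Qed.

Lemma powR_mulB1 (p x : R) : 0 < x -> x * x `^ (p - 1) = x `^ p.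
Proof.
move=> x0; rewrite -{1}[x]powRr1 ?(ltW x0)// -powRD; last by apply/implyP => _; rewrite gt_eqF.
by congr powR; ring.
Qed.

(** As alpha <= 1, y^(alpha - 1) >= x^(alpha - 1), whence y^alpha >= y x^(alpha - 1). The slope is
    taken at the larger point, so the bound does not blow up as y tends to 0. *)
Lemma powR_diff_le (alpha x y : R) : alpha <= 1 -> 0 < y -> y <= x ->
  x `^ alpha - y `^ alpha <= (x - y) * x `^ (alpha - 1).
Proof.
move=> a1 y0 yx; have x0 := lt_le_trans y0 yx.
have xa := powR_mulB1 alpha x0; have ya := powR_mulB1 alpha y0.
rewrite mulrBl xa lerB// -ya ler_pM2l//.
rewrite -(opprB 1 alpha) !powRN lef_pV2 ?posrE ?powR_gt0//.
by apply: ge0_ler_powR; rewrite ?nnegrE ?subr_ge0// ltW.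
Qed.

End KernelBounds.

Section Extremum.
Context {R : realType}.
Local Notation mu := (@lebesgue_measure R).
Variables (alpha t : R).
Hypotheses (alpha0 : 0 < alpha) (alpha1 : alpha < 1) (t0 : 0 < t).
Variables (f g : R -> R).
Hypotheses (cf : continuous f) (cg : continuous g).
Hypothesis fE : forall r, 0 < r -> r <= t ->
  f r = \int[mu]_(s in `]0, r[) ((r - s) `^ (alpha - 1) * g s).
Hypothesis fmax : forall r, 0 < r -> r <= t -> f r <= f t.

Let al0 : alpha != 0. Proof. by rewrite gt_eqF. Qed.
Let al1 : 0 < 1 - alpha. Proof. by rewrite subr_gt0. Qed.

Let mg : measurable_fun [set: R] g.
Proof. exact: continuous_measurable_fun. Qed.

Let integrable_conv r : 0 < r -> r <= t ->
  mu.-integrable `]0, r[ (fun s => ((r - s) `^ (alpha - 1) * g s)%:E).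
Proof.
move=> r0 rt; have [M M0 gM] := continuous_bounded_itv (ltW r0) cg.
apply: (@EFin_integrable_bounded _ _ _ _ M) => //.
  by apply: integrable_powRBl; rewrite ?alpha0 ?orbT.
by move=> s /=; rewrite in_itv/= => /andP[s0 sr]; apply: gM; rewrite ltW.
Qed.

Section Epsilon.
Variables (eps : R).
Hypotheses (eps0 : 0 < eps) (epst : eps < t).
Let tau := t - eps.
Let tau0 : 0 < tau. Proof. by rewrite subr_gt0. Qed.
Let taut : tau < t. Proof. by rewrite ltrBlDr ltrDl. Qed.

(** Up to a constant, the kernel of the Marchaud form of the fractional derivative, cut off at
    distance [eps] from its singularity as f is only continuous. [Phi] is its composition with the
    kernel of the fractional integral; its factor 1 / (t - s) is written as a power, which eases
    measurability. *)
Let rho r := alpha * (t - r) `^ (- alpha - 1).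
Let Phi s := eps `^ (- alpha) * (tau - s) `^ alpha * (t - s) `^ (-1).

Let PhiE s : s < t -> Phi s = eps `^ (- alpha) * (tau - s) `^ alpha / (t - s).
Proof. by move=> st; rewrite /Phi powR_inv1// subr_ge0 ltW. Qed.

Let rho0 r : 0 <= rho r.
Proof. by rewrite mulr_ge0 ?powR_ge0// ltW. Qed.

Let Phi_le s : 0 < s -> s < tau -> Phi s <= eps `^ (- alpha) * t `^ alpha / eps.
Proof.
move=> s0 st; rewrite PhiE ?(lt_trans st)//.
have h1 : eps <= t - s by move: st; rewrite /tau; lra.
apply: ler_pM; rewrite ?mulr_ge0 ?powR_ge0 ?invr_ge0 ?subr_ge0//.
- by rewrite (ltW (lt_trans st taut)).
- apply: ler_wpM2l; first exact: powR_ge0.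
  apply: ge0_ler_powR; rewrite ?nnegrE ?subr_ge0 ?ltW//.
  by move: s0 taut; lra.
- by rewrite lef_pV2 ?posrE// (lt_le_trans eps0).
Qed.

Let mkern : measurable_fun [set: R * R]
  (fun p : R * R => rho p.1 * (p.1 - p.2) `^ (alpha - 1)).
Proof.
apply: measurable_funM.
  apply: measurable_funM => //.
  apply: (measurableT_comp (measurable_powR _)).
  exact: measurable_funB.
apply: (measurableT_comp (measurable_powR _)).
exact: measurable_funB.
Qed.

Let mPhi : measurable_fun [set: R] Phi.
Proof.
apply: measurable_funM; first apply: measurable_funM => //.
  by apply: (measurableT_comp (measurable_powR _)); exact: measurable_funB.
by apply: (measurableT_comp (measurable_powR _)); exact: measurable_funB.
Qed.

(** Fubini on the triangle: the mean of the fractional integral is an integral of g against [Phi],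
    in closed form by [integral_powR_beta]. *)
Let average : \int[mu]_(r in `]0, tau[) (rho r * f r) =
  \int[mu]_(s in `]0, tau[) (Phi s * g s).
Proof.
rewrite -(@triangle_fubini _ tau (eps `^ (- alpha) * t `^ alpha / eps)
  (fun r s => rho r * (r - s) `^ (alpha - 1)) Phi g).
- apply: eq_Rintegral => r /set_mem/=; rewrite in_itv/= => /andP[r0 rt].
  rewrite fE//; last by rewrite ltW// (lt_trans rt).
  rewrite -RintegralZl//; last by apply: integrable_conv => //; rewrite ltW// (lt_trans rt).
  by apply: eq_Rintegral => s _; rewrite mulrA.
- exact: mkern.
- by move=> r s *; rewrite mulr_ge0 ?powR_ge0.
- move=> s s0 st; rewrite (integral_powR_beta alpha0 st taut).
  by rewrite PhiE ?(lt_trans st)// /tau opprB addrC subrK.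
- exact: Phi_le.
- exact: mg.
- exact: continuous_integrable_itv.
Qed.

Let irho : mu.-integrable `]0, tau[ (fun r => (rho r)%:E).
Proof.
apply: EFin_integrableZl => //; apply: integrable_powRBl.
- by rewrite oppr_eq0.
- exact: ltW.
- by rewrite taut.
Qed.

Let rho_mass : \int[mu]_(r in `]0, tau[) rho r = eps `^ (- alpha) - t `^ (- alpha).
Proof.
rewrite RintegralZl//; last first.
  by apply: integrable_powRBl; rewrite ?oppr_eq0 ?taut// ltW.
rewrite Rintegral_powRBl ?oppr_eq0 ?taut ?tau0 ?(ltW taut)//.
by rewrite subr0 /tau opprB (addrC t) subrK; field.
Qed.

Let average_le : \int[mu]_(s in `]0, tau[) (Phi s * g s) <=
  f t * (eps `^ (- alpha) - t `^ (- alpha)).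
Proof.
rewrite -average -rho_mass -RintegralZl//.
have [M M0 fM] := continuous_bounded_itv (ltW tau0) cf.
apply: le_Rintegral => //.
- apply: (@EFin_integrable_bounded _ _ _ _ M) => //.
    exact: continuous_measurable_fun.
  by move=> s /=; rewrite in_itv/= => /andP[s0 sr]; apply: fM; rewrite ltW.
- by apply: EFin_integrableZl.
- move=> r /=; rewrite in_itv/= => /andP[r0 rt].
  by rewrite mulrC ler_wpM2r// fmax// ltW// (lt_trans rt).
Qed.

(** The weight of g on ]0, tau[ in eps^(- alpha) f(t) minus the mean of f. *)
Let kappa s := eps `^ (- alpha) * (t - s) `^ (alpha - 1) - Phi s.

(** Up to the factor eps^(- alpha) / (t - s), [kappa] is the increment of the power alpha from tau -
    s to t - s, an interval of length eps; [powR_diff_le] applies. *)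
Let kappa_bounds s : 0 < s -> s < tau ->
  0 <= kappa s <= eps `^ (1 - alpha) * (t - s) `^ (alpha - 1 - 1).
Proof.
move=> s0 st; have ts : 0 < t - s by rewrite subr_gt0 (lt_trans st).
have xa : (t - s) `^ (alpha - 1) = (t - s) `^ alpha / (t - s).
  by rewrite -(powR_mulB1 alpha ts) mulrAC mulfV ?mul1r// gt_eqF.
have xa2 : (t - s) `^ (alpha - 1 - 1) = (t - s) `^ (alpha - 1) / (t - s).
  rewrite powRB ?powRr1 ?(ltW ts)//; by rewrite (gt_eqF ts) implybT.
have ea : eps `^ (1 - alpha) = eps * eps `^ (- alpha).
  by rewrite powRD ?powRr1 ?(ltW eps0)// gt_eqF// implybT.
have -> : kappa s = eps `^ (- alpha) / (t - s) * ((t - s) `^ alpha - (tau - s) `^ alpha).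
  by rewrite /kappa PhiE ?(lt_trans st)// xa; ring.
have c0 : 0 <= eps `^ (- alpha) / (t - s) by rewrite divr_ge0 ?powR_ge0// ltW.
have tts : 0 < tau - s by rewrite subr_gt0.
have le_ts : tau - s <= t - s by rewrite lerD2r ltW.
apply/andP; split.
  rewrite mulr_ge0// subr_ge0; apply: ge0_ler_powR; rewrite ?nnegrE// ltW//.
rewrite xa2 ea.
have := powR_diff_le (ltW alpha1) tts le_ts.
have -> : t - s - (tau - s) = eps by rewrite /tau; ring.
move/(ler_wpM2l c0)/le_trans; apply.
by rewrite le_eqVlt; apply/orP; left; apply/eqP; ring.
Qed.

(** Subtracting [average_le] from eps^(- alpha) f(t) leaves t^(- alpha) f(t) on the left. On the
    right ]tau, t[ contributes H / alpha and [kappa] near t contributes H / (1 - alpha), the two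
    parts of the constant. At distance more than delta from t, [kappa] is at most eps^(1 - alpha)
    delta^(alpha - 2), so the crude bound Gam suffices there. *)
Lemma extremum_eps H Gam delta : 0 <= H -> 0 <= Gam -> eps < delta ->
  (forall s, t - delta <= s -> s <= t -> g s <= H) ->
  (forall s, 0 <= s -> s <= t -> g s <= Gam) ->
  t `^ (- alpha) * f t <= H * (alpha^-1 + (1 - alpha)^-1) +
    Gam * t * delta `^ (alpha - 1 - 1) * eps `^ (1 - alpha).
Proof.
move=> H0 Gam0 ed gH gGam.
have d0 : 0 < delta := lt_trans eps0 ed.
have it : mu.-integrable `]0, t[ (fun s => ((t - s) `^ (alpha - 1) * g s)%:E).
  exact: integrable_conv.
have iS (D : set R) : measurable D -> D `<=` `]0, t[ ->
    mu.-integrable D (fun s => ((t - s) `^ (alpha - 1) * g s)%:E).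
  by move=> mD Dt; apply: integrableS it.
have sub1 : (`]0, tau[ : set R) `<=` `]0, t[.
  by apply: subset_itvl; rewrite bnd_simp ltW.
have sub2 : (`]tau, t[ : set R) `<=` `]0, t[.
  by apply: subset_itvr; rewrite bnd_simp ltW.
have := fE t0 (lexx _).
rewrite (Rintegral_split tau0 taut)//.
set I1 := \int[mu]_(s in `]0, tau[) _; set I2 := \int[mu]_(s in `]tau, t[) _ => ftE.
have iPhi : mu.-integrable `]0, tau[ (fun s => (Phi s * g s)%:E).
  have [M M0 gM] := continuous_bounded_itv (ltW tau0) cg.
  have ig : mu.-integrable `]0, tau[ (fun s => (g s)%:E) by exact: continuous_integrable_itv.
  have h : mu.-integrable `]0, tau[ (fun s => (g s * Phi s)%:E).
    apply: (@EFin_integrable_bounded _ _ _ _ (eps `^ (- alpha) * t `^ alpha / eps)) => //.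
    move=> s /=; rewrite in_itv/= => /andP[s0 st].
    by rewrite ger0_norm; [exact: Phi_le|rewrite !mulr_ge0 ?powR_ge0].
  by apply: lebesgue_eq_integrable h => // s _; rewrite mulrC.
have ik : mu.-integrable `]0, tau[ (fun s => ((t - s) `^ (alpha - 1 - 1))%:E).
  apply: integrable_powRBl; rewrite ?taut ?(ltW taut)//.
  by rewrite -oppr_eq0 opprB gt_eqF.
have B2 : I2 <= H * (eps `^ alpha / alpha).
  have <- : \int[mu]_(s in `]tau, t[) (H * (t - s) `^ (alpha - 1)) = H * (eps `^ alpha / alpha).
    rewrite RintegralZl//; last by apply: integrable_powRBl; rewrite ?alpha0 ?orbT.
    rewrite Rintegral_powRBl ?alpha0 ?orbT// subrr powR0// subr0 /tau.
    by rewrite opprB (addrC t) subrK.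
  apply: le_Rintegral => //.
  - exact: iS.
  - by apply: EFin_integrableZl => //; apply: integrable_powRBl; rewrite ?alpha0 ?orbT.
  - move=> s /=; rewrite in_itv/= => /andP[s0 st].
    rewrite mulrC ler_wpM2r ?powR_ge0//; apply: gH; last exact: ltW.
    by move: s0; rewrite /tau; lra.
have B1 : eps `^ (- alpha) * I1 - \int[mu]_(s in `]0, tau[) (Phi s * g s) <=
   H / (1 - alpha) + Gam * t * delta `^ (alpha - 1 - 1) * eps `^ (1 - alpha).
  rewrite /I1 -RintegralZl//; last exact: iS.
  rewrite -RintegralB//; last by apply: EFin_integrableZl => //; exact: iS.
  pose C := Gam * delta `^ (alpha - 1 - 1) * eps `^ (1 - alpha).
  have C0 : 0 <= C by rewrite !mulr_ge0 ?powR_ge0.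
  have iC : mu.-integrable `]0, tau[ (fun=> C%:E).
    by apply: (@continuous_integrable_itv _ (cst C)) => x; exact: cvg_cst.
  have iU : mu.-integrable `]0, tau[ 
      (fun s => (H * eps `^ (1 - alpha) * (t - s) `^ (alpha - 1 - 1) + C)%:E).
    by apply: EFin_integrableD => //; exact: EFin_integrableZl.
  apply: (@le_trans _ _ (\int[mu]_(s in `]0, tau[)
     (H * eps `^ (1 - alpha) * (t - s) `^ (alpha - 1 - 1) + C))).
    apply: le_Rintegral => //.
    - apply: EFin_integrableB => //; apply: EFin_integrableZl => //; exact: iS.
    - move=> s /=; rewrite in_itv/= => /andP[s0 st].
      have /andP[k0 k1] := kappa_bounds s0 st.
      rewrite [leLHS](_ : _ = kappa s * g s); last by rewrite /kappa; ring.
      have ts0 : 0 <= t - s by rewrite subr_ge0 ltW// (lt_trans st).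
      have [dts|tsd] := leP (t - delta) s.
        apply: (@le_trans _ _ (kappa s * H)).
          by apply: ler_wpM2l => //; apply: gH => //; rewrite ltW// (lt_trans st).
        rewrite mulrC -mulrA -[leLHS]addr0; apply: lerD => //.
        exact: ler_wpM2l.
      apply: (@le_trans _ _ (kappa s * Gam)).
        by apply: ler_wpM2l => //; apply: gGam; rewrite ltW// (lt_trans st).
      rewrite -[leLHS]add0r; apply: lerD; first by rewrite !mulr_ge0 ?powR_ge0.
      rewrite /C mulrC -mulrA; apply: ler_wpM2l => //.
      apply: (le_trans k1); rewrite mulrC; apply: ler_wpM2r; first exact: powR_ge0.
      have dts : delta <= t - s by move: tsd; lra.
      rewrite -(opprB 1 (alpha - 1)) !powRN lef_pV2 ?posrE ?powR_gt0//; last exact: lt_le_trans dts.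
      apply: ge0_ler_powR; rewrite ?nnegrE// ?(ltW d0)//.
      by move: alpha1; lra.
  rewrite RintegralD//; last exact: EFin_integrableZl.
  rewrite RintegralZl// Rintegral_powRBl ?taut ?(ltW taut)//; last first.
    by rewrite -oppr_eq0 opprB gt_eqF.
  apply: lerD.
    have -> : t - tau = eps by rewrite /tau; ring.
    have e1 : eps `^ (1 - alpha) * eps `^ (alpha - 1) = 1.
      by rewrite -(opprB 1 alpha) powRN mulfV// gt_eqF// powR_gt0.
    rewrite subr0 -mulrA; apply: ler_wpM2l => //.
    have n1 : 1 - alpha != 0 by rewrite gt_eqF.
    have n2 : alpha - 1 != 0 by rewrite -oppr_eq0 opprB.
    (* The mass is (1 - (eps / t)^(1 - alpha)) / (1 - alpha), at most 1 / (1 - alpha). *)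
    rewrite [leLHS](_ : _ = (eps `^ (1 - alpha) * eps `^ (alpha - 1) -
        eps `^ (1 - alpha) * t `^ (alpha - 1)) / (1 - alpha)); last first.
      by field; rewrite ?n1 ?n2.
    rewrite e1 ler_pdivrMr// mulVf// lerBlDr lerDl.
    by rewrite mulr_ge0 ?powR_ge0.
  rewrite Rintegral_cst//= lebesgue_measure_itv/= lte_fin tau0/= subr0.
  rewrite /C; apply: (@le_trans _ _ (Gam * delta `^ (alpha - 1 - 1) * eps `^ (1 - alpha) * t)).
    by apply: ler_wpM2l => //; exact: ltW.
  by rewrite le_eqVlt; apply/orP; left; apply/eqP; ring.
have e1 : eps `^ (- alpha) * eps `^ alpha = 1.
  by rewrite powRN mulVf// gt_eqF// powR_gt0.
have B2' : eps `^ (- alpha) * I2 <= H / alpha.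
  rewrite (le_trans (ler_wpM2l _ B2)) ?powR_ge0//.
  by rewrite mulrCA (mulrA (eps `^ (- alpha))) e1 mul1r.
have := average_le.
rewrite mulrDr.
have : eps `^ (- alpha) * f t = eps `^ (- alpha) * I1 + eps `^ (- alpha) * I2.
  by rewrite ftE mulrDr.
lra.
Qed.

End Epsilon.

(* [average_le] bounds the mean of [f] with weight [rho] on [[0, t - eps]] by its
   maximum [f t]; the statement is the limit [eps --> 0]. *)
Lemma frac_extremum G : 0 <= G -> g t <= G ->
  f t <= (alpha^-1 + (1 - alpha)^-1) * t `^ alpha * G.
Proof.
move=> G0 gtG; set c := alpha^-1 + (1 - alpha)^-1.
have c0 : 0 < c by rewrite addr_gt0 ?invr_gt0.
have [Gam Gam0 gGam] := continuous_bounded_itv (ltW t0) cg.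
suff: t `^ (- alpha) * f t <= c * G.
  rewrite powRN mulrC ler_pdivrMr ?powR_gt0// => /le_trans; apply.
  by rewrite mulrAC.
apply/ler_addgt0Pr => e e0.
(* Half of e pays for the oscillation of g near t, which costs the factor c; the other half for the
   far part, made small through eps. D + 1 avoids a division by 0. *)
have e1 : 0 < e / (2 * c) by rewrite divr_gt0// mulr_gt0.
have [d d0 Hd] : exists2 d, 0 < d & forall s, t - d <= s -> s <= t -> g s <= G + e / (2 * c).
  have /cvgrPdist_le/(_ _ e1)/nbhs_ballP[d /= d0 Hd] : g x @[x --> t] --> g t by exact: cg.
  exists (d / 2) => [|s ds st]; first by rewrite divr_gt0.
  have : ball t d s.
    rewrite -ball_normE/= ger0_norm ?subr_ge0//; move: ds d0; lra.
  by move/Hd; rewrite ler_norml => /andP[h _]; move: h gtG; lra.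
set D := Gam * t * d `^ (alpha - 1 - 1).
have D0 : 0 <= D by rewrite !mulr_ge0 ?powR_ge0// ltW.
have e2 : 0 < e / (2 * (D + 1)) by rewrite divr_gt0// mulr_gt0// ltr_wpDl.
have : \forall eps \near 0^'+, eps `^ (1 - alpha) <= e / (2 * (D + 1)).
  have /cvgrPdist_le/(_ _ e2) := @powR_cvg0 R (1 - alpha) al1.
  by apply: filterS => x; rewrite sub0r normrN ger0_norm ?powR_ge0.
move=> hnear.
near (0 : R)^'+ => eps.
have eps0 : 0 < eps by near: eps; exact: nbhs_right_gt.
have epst : eps < t by near: eps; exact: nbhs_right_lt.
have epsd : eps < d by near: eps; exact: nbhs_right_lt.
have heps : eps `^ (1 - alpha) <= e / (2 * (D + 1)) by near: eps.
have := @extremum_eps eps eps0 epst (G + e / (2 * c)) Gam d _ Gam0 epsd Hd _.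
move=> /(_ _ _)/le_trans; apply.
- by rewrite addr_ge0// ltW.
- by move=> s s0 st; rewrite (le_trans (ler_norm _))// gGam.
- rewrite -/c -/D.
  have h1 : (G + e / (2 * c)) * c = c * G + e / 2 by field; rewrite gt_eqF.
  have h2 : D * eps `^ (1 - alpha) <= e / 2.
    apply: (le_trans (ler_wpM2l D0 heps)).
    have D1 : 0 < D + 1 by rewrite ltr_wpDl.
    rewrite [leLHS](_ : _ = e / 2 * (D / (D + 1))); last by field; rewrite gt_eqF.
    by rewrite ler_piMr ?divr_ge0 ?(ltW e0)// ler_pdivrMr// mul1r lerDl.
  by rewrite h1; lra.
Unshelve. all: end_near. Qed.

End Extremum.

(** * The integrated equation *)

Section TestFunctions.
Context {R : realType} {X : completeNormedModType R}.
Variable ip : {dot X for (@idfun R)}.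
Hypothesis hip : induces_norm ip.
Local Notation mu := (@lebesgue_measure R).
Variables (T : R).
Hypothesis (T0 : 0 < T).

Lemma lebesgue_itv_oo_fin (a b : R) : (mu `]a, b[ < +oo)%E.
Proof. by rewrite lebesgue_measure_itv/=; case: ifPn => _; rewrite -?EFinB ltry. Qed.

Lemma L2_nice (u : R -> X) : L2 T u -> exists w,
  [/\ nice w, (forall t, ~ `]0, T[%classic t -> w t = 0),
      norm_integrable `]0, T[ w & u = w %[ae mu in `]0, T[%classic]].
Proof.
move=> [su iu].
have [w [nw w0 uw]] := nice_version (measurable_itv _) su.
exists w; split=> //; apply: norm_integrableE => //.
have mw2 : measurable_fun `]0, T[ (fun t => ((`|w t|) ^+ 2)%:E).
  apply/measurable_EFinP; apply: measurable_funTS; apply: measurable_funX; exact: nice_norm.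
have iw : (\int[mu]_(t in `]0%R, T[) ((`|w t|) ^+ 2)%:E < +oo)%E.
  apply: le_lt_trans iu; rewrite le_eqVlt; apply/orP; left; apply/eqP/esym.
  apply: ae_eq_integral_nomeas.
  by apply: filterS uw; [exact: (ae_filter_ringOfSetsType mu)|move=> t h /h ->].
(* On a bounded interval L^2 lies in L^1, by |w| <= 1 + |w|^2. *)
apply: (@le_lt_trans _ _ (\int[mu]_(t in `]0%R, T[) (1 + (`|w t|) ^+ 2)%:E)%E).
  apply: ge0_le_integral => //.
  - by apply/measurable_EFinP; apply: measurable_funTS; exact: nice_norm.
  - by apply/measurable_EFinP; apply: measurable_funD => //; exact/measurable_EFinP.
  - by move=> t _; rewrite lee_fin; have := sqr_ge0 (`|w t| - 2^-1); lra.
under eq_integral do rewrite EFinD.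
rewrite ge0_integralD//.
rewrite integral_cst// mul1e.
by rewrite lte_add_pinfty//; exact: lebesgue_itv_oo_fin.
Qed.

Lemma L2_scaled (eta : R -> R) (C : R) (y : X) : measurable_fun [set: R] eta ->
  (forall t, 0 <= eta t) -> (forall t, 0 < t -> t < T -> eta t <= C) ->
  L2 T (fun t => eta t *: y).
Proof.
move=> meta eta0 etaC.
have ny : nice (fun t => eta t *: y).
  by apply: niceZ => //; apply: nice_fin; exact: fin_meas_cst.
split; first exact: nice_strongly_measurable.
apply: (@le_lt_trans _ _ (\int[mu]_(t in `]0%R, T[) ((C * `|y|) ^+ 2)%:E)%E).
  apply: ge0_le_integral => //.
  - by apply/measurable_EFinP; apply: measurable_funTS; apply: measurable_funX; exact: nice_norm.
  - move=> t /=; rewrite in_itv/= => /andP[t0 tT].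
    rewrite lee_fin ler_sqr ?nnegrE ?mulr_ge0// ?(le_trans (eta0 t) (etaC t t0 tT))//.
    by rewrite normrZ ger0_norm// ler_wpM2r// etaC.
rewrite integral_cst//= lebesgue_measure_itv/= lte_fin T0.
by rewrite -EFinB -EFinM ltry.
Qed.

Variable A : unbounded_operator X.

(** The hypothesis relating y and z says that y is in the domain of the adjoint of A with image
    z. *)
Lemma pointwise_adjoint (eta : R -> R) (C : R) (y z : X) : measurable_fun [set: R] eta ->
  (forall t, 0 <= eta t) -> (forall t, 0 < t -> t < T -> eta t <= C) ->
  (forall p, dom A p -> ip (A p) y = ip p z) ->
  L2_adjoint ip T (pointwise_operator T A) (fun t => eta t *: y) (fun t => eta t *: z).
Proof.
move=> meta eta0 etaC yz; split; [exact: L2_scaled etaC|exact: L2_scaled etaC|].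
move=> v w [[[s [_ hv]] _] _ wv].
apply: ae_eq_Rintegral.
apply: filterS2 hv wv; first exact: (ae_filter_ringOfSetsType mu).
move=> t h1 h2 Dt; have [dv _] := h1 Dt.
by rewrite (h2 Dt) !ipZr yz.
Qed.

Variable alpha : R.
Hypotheses (alpha0 : 0 < alpha).
Local Notation G := ((Gamma alpha)^-1).

Lemma Gamma_ge0 : 0 <= G.
Proof.
rewrite invr_ge0; apply: Rintegral_ge0 => t _.
by rewrite mulr_ge0 ?powR_ge0// ltW// expR_gt0.
Qed.

Definition cutoff (tau t : R) : R := if t < tau then 1 else 0.
(** The backward fractional integral of order alpha, from t to tau, of the indicator [cutoff]; hence
    the adjoint fractional derivative leads back to [cutoff]. *)
Definition cutoff_int (tau t : R) : R :=
  if t < tau then G * (tau - t) `^ alpha / alpha else 0.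

Lemma measurable_cutoff tau : measurable_fun [set: R] (cutoff tau).
Proof. by apply: measurable_fun_ifT => //; exact: measurable_fun_ltr. Qed.

Lemma measurable_cutoff_int tau : measurable_fun [set: R] (cutoff_int tau).
Proof.
apply: measurable_fun_ifT => //; first exact: measurable_fun_ltr.
apply: measurable_funM => //; apply: measurable_funM => //.
by apply: (measurableT_comp (measurable_powR _)); exact: measurable_funB.
Qed.

Lemma cutoff_int_ge0 tau t : 0 <= cutoff_int tau t.
Proof.
rewrite /cutoff_int; case: ifPn => // _.
by rewrite divr_ge0 ?mulr_ge0 ?powR_ge0 ?Gamma_ge0// ltW.
Qed.

Lemma cutoff_int_le tau t : 0 < tau -> 0 < t -> t < T ->
  cutoff_int tau t <= G * tau `^ alpha / alpha.
Proof.
move=> tau0 t0 _; rewrite /cutoff_int; case: ifPn => [tt|_]; last first.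
  by rewrite divr_ge0 ?mulr_ge0 ?powR_ge0 ?Gamma_ge0// ltW.
apply: ler_wpM2r; first by rewrite invr_ge0 ltW.
apply: ler_wpM2l; first exact: Gamma_ge0.
by apply: ge0_ler_powR; rewrite ?nnegrE ?subr_ge0 ?ltW// ltrBlDr ltrDl.
Qed.

Lemma Rintegral_cutoff (tau : R) (h k : R -> R) : tau <= T ->
  (forall t, 0 < t -> t < tau -> h t = k t) ->
  (forall t, tau <= t -> h t = 0) ->
  \int[mu]_(t in `]0, T[) h t = \int[mu]_(t in `]0, tau[) k t.
Proof.
move=> tauT hk h0; rewrite Rintegral_mkcond [RHS]Rintegral_mkcond.
apply: eq_Rintegral => t _; rewrite !patchE.
have [tt|tt] := ltP t tau.
  have [t0|t0] := ltP 0 t.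
    by rewrite !mem_set/= ?in_itv/= ?t0 ?tt ?(lt_le_trans tt tauT)// hk.
  by rewrite !memNset//= in_itv/= ltNge t0.
rewrite (memNset (A := `]0, tau[%classic)); last by rewrite /= in_itv/= [t < tau]ltNge tt andbF.
by case: ifPn => // _; exact: h0.
Qed.

(** Fubini: integrating the fractional integral of f over ]0, tau[ weights f(s) with the integral of
    the kernel over t in ]s, tau[. *)
Lemma frac_adjoint (tau : R) (y : X) : 0 < tau -> tau <= T ->
  L2_adjoint ip T (@frac_derivative R X T alpha)
    (fun t => cutoff_int tau t *: y) (fun t => cutoff tau t *: y).
Proof.
move=> tau0 tauT; split.
- apply: (@L2_scaled _ (G * tau `^ alpha / alpha)).
  + exact: measurable_cutoff_int.
  + by move=> t; exact: cutoff_int_ge0.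
  + by move=> t t0 tT; exact: cutoff_int_le.
- apply: (@L2_scaled _ 1).
  + exact: measurable_cutoff.
  + by move=> t; rewrite /cutoff; case: ifPn.
  + by move=> t _ _; rewrite /cutoff; case: ifPn.
move=> v f [_ f2 vf].
have [w [nw w0 [_ iw] fw]] := L2_nice f2.
pose omega t := ip (w t) y.
have mom : measurable_fun [set: R] omega by exact: nice_ip.
have sub_tau : (`]0, tau[ : set R) `<=` `]0, T[ by apply: subset_itvl; rewrite bnd_simp.
have iw_tau : norm_integrable `]0, tau[ w.
  by split=> //; apply: integrableS iw.
pose Phi s := (tau - s) `^ alpha / alpha.
have mk : measurable_fun [set: R * R] (fun p : R * R => (p.1 - p.2) `^ (alpha - 1)).
  by apply: (measurableT_comp (measurable_powR _)); exact: measurable_funB.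
have k0 (t s : R) : 0 < s -> s < t -> t < tau -> 0 <= (t - s) `^ (alpha - 1).
  by move=> *; exact: powR_ge0.
have kPhi (s : R) : 0 < s -> s < tau ->
    (\int[mu]_(t in `]s, tau[) ((t - s) `^ (alpha - 1))%:E = (Phi s)%:E)%E.
  by move=> s0 st; rewrite integral_powRBr.
have PhiM (s : R) : 0 < s -> s < tau -> Phi s <= tau `^ alpha / alpha.
  move=> s0 st; apply: ler_wpM2r; first by rewrite invr_ge0 ltW.
  by apply: ge0_ler_powR; rewrite ?nnegrE ?subr_ge0 ?ltW// ltrBlDr ltrDl.
have iom : mu.-integrable `]0, tau[ (fun s => (omega s)%:E) by exact: integrable_ip.
have inw : mu.-integrable `]0, tau[ (fun s => (`|w s|)%:E) by case: iw_tau.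
transitivity (\int[mu]_(t in `]0, tau[) (G * Phi t * omega t)).
  transitivity (\int[mu]_(t in `]0, T[) (cutoff_int tau t * omega t)).
    apply: ae_eq_Rintegral.
    apply: filterS fw; first exact: (ae_filter_ringOfSetsType mu).
    by move=> t h /h ->; rewrite ipZr.
  apply: Rintegral_cutoff => // t; first by move=> t0 tt; rewrite /cutoff_int tt /Phi; ring.
  by move=> tt; rewrite /cutoff_int ltNge tt mul0r.
rewrite -(@triangle_fubini _ tau (G * (tau `^ alpha / alpha))
  (fun t s => G * (t - s) `^ (alpha - 1)) (fun s => G * Phi s) omega)//; last 4 first.
- exact: measurable_funM.
- by move=> t s *; rewrite mulr_ge0 ?Gamma_ge0 ?powR_ge0.
- move=> s s0 st; under eq_integral do rewrite EFinM.
  rewrite EFin_integralZl// ?kPhi//.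
  exact: integrable_powRBr.
- by move=> s s0 st; rewrite ler_wpM2l ?Gamma_ge0// PhiM.
transitivity (\int[mu]_(t in `]0, tau[) (ip (frac_integral alpha f t) y)).
  apply: ae_eq_Rintegral.
  (* Applied to the norm of w: for almost every t the singular integrand is norm-integrable, and the
     Bochner integral may be paired with y under the integral sign. *)
  have := triangle_integrable mk k0 kPhi PhiM (nice_norm nw) inw.
  apply: filterS; first exact: (ae_filter_ringOfSetsType mu).
  move=> t it /=; rewrite in_itv/= => /andP[t0 tt].
  rewrite /frac_integral ipZl.
  have nkw : nice (fun s => (t - s) `^ (alpha - 1) *: w s).
    apply: niceZ => //; last by move=> s; exact: powR_ge0.
    by apply: (measurableT_comp (measurable_powR _)); exact: measurable_funB.
  have ikw : norm_integrable `]0, t[ (fun s => (t - s) `^ (alpha - 1) *: w s).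
    split=> //; apply: lebesgue_eq_integrable (it t0 tt) => // s _.
    by rewrite normrZ ger0_norm ?powR_ge0.
  have fkw : (fun s => (t - s) `^ (alpha - 1) *: f s) =
      (fun s => (t - s) `^ (alpha - 1) *: w s) %[ae mu in `]0, t[%classic].
    apply: filterS fw; first exact: (ae_filter_ringOfSetsType mu).
    move=> s h st; rewrite h//; move: st; apply: subset_itvl.
    by rewrite bnd_simp (le_trans (ltW tt)).
  have /(_ y) := bochner_weak hip (measurable_itv _) (lebesgue_itv_oo_fin 0 t) ikw fkw.
  move=> ->; rewrite -RintegralZl//; last exact: integrable_ip.
  by apply: eq_Rintegral => s _; rewrite ipZl mulrA.
apply/esym.
transitivity (\int[mu]_(t in `]0, T[) (cutoff tau t * ip (frac_integral alpha f t) y)).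
  apply: ae_eq_Rintegral.
  apply: filterS vf; first exact: (ae_filter_ringOfSetsType mu).
  by move=> t h /h ->; rewrite ipZr.
apply: Rintegral_cutoff => // t; first by move=> t0 tt; rewrite /cutoff tt mul1r.
by move=> tt; rewrite /cutoff ltNge tt mul0r.
Qed.

End TestFunctions.

Section Primitive.
Context {R : realType} {X : completeNormedModType R}.
Variable ip : {dot X for (@idfun R)}.
Hypothesis hip : induces_norm ip.
Local Notation mu := (@lebesgue_measure R).
Variable T : R.
Variable w : R -> X.
Hypothesis iw : norm_integrable `]0, T[ w.
Hypothesis w0 : forall t, ~ `]0, T[%classic t -> w t = 0.

Lemma norm_integrable_sub (D : set R) : measurable D -> norm_integrable D w.
Proof.
move=> mD; have [nw iw'] := iw; split=> //.
apply: (@integrableS _ _ _ mu setT) => //.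
move/integrable_mkcond : iw' => /(_ (measurable_itv _)).
apply: lebesgue_eq_integrable => // t _; rewrite patchE; case: ifPn => // tT.
by rewrite w0 ?normr0//; move=> /mem_set; exact/negP.
Qed.

(** Integrating from minus infinity defines the primitive at negative times too, where it vanishes.
    Translates then need no special case, and the form suits Lebesgue differentiation. *)
Definition prim (t : R) : X := xget 0 (weak_integral ip `]-oo, t] w).

Lemma primP t z : ip (prim t) z = \int[mu]_(s in `]-oo, t]) ip (w s) z.
Proof.
have mI : measurable (`]-oo, t]%classic : set R) by exact: measurable_itv.
have := weak_integral_exists hip mI (norm_integrable_sub mI).
by move/(@xgetPex _ 0 (weak_integral ip `]-oo, t] w)); apply.
Qed.

Lemma prim_le0 t : t <= 0 -> prim t = 0.
Proof.
move=> t0; apply: (eq_ip hip) => z; rewrite primP ip0l.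
rewrite /Rintegral integral0_eq// => s /=; rewrite in_itv/= => st.
by rewrite w0 ?ip0l//= in_itv/= ltNge (le_trans st t0).
Qed.

Lemma prim_oo t z : ip (prim t) z = \int[mu]_(s in `]0, t[) ip (w s) z.
Proof.
rewrite primP -(@Rintegral_itv_bndo_bndc _ -oo%O t); last first.
  by apply: (integrable_ip hip); [|exact: norm_integrable_sub].
rewrite Rintegral_mkcond [RHS]Rintegral_mkcond; apply: eq_Rintegral => s _.
rewrite !patchE; have [s0|s0] := ltP 0 s.
  by rewrite !mem_setE !in_itv/= s0.
rewrite (memNset (A := `]0, t[%classic)); last by rewrite /= in_itv/= ltNge s0.
by case: ifPn => // _; rewrite w0 ?ip0l//= in_itv/= ltNge s0.
Qed.

Lemma norm_primB x y : y <= x -> `|prim x - prim y| <= \int[mu]_(s in `]y, x]) `|w s|.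
Proof.
move=> yx; apply: (le_norm_weak_integral hip) => //; first exact: norm_integrable_sub.
move=> z; rewrite ipBl !primP.
rewrite -(@Rintegral_itvB _ _ -oo%O (BRight x))//.
by apply: (integrable_ip hip); [|exact: norm_integrable_sub].
Qed.

(** Increments are dominated by those of the scalar function t -> ∫ |w|, started at t - 1 so that
    points on both sides of t are covered. *)
Lemma prim_continuous : continuous prim.
Proof.
move=> t; pose F x := \int[mu]_(s in `[t - 1, x]) `|w s|.
have iF x y : mu.-integrable `[x, y] (fun s => (`|w s|)%:E).
  by have [] := norm_integrable_sub (measurable_itv `[x, y]).
have cF : F x @[x --> t] --> F t.
  have t1 : t - 1 < t + 1 by lra.
  have /(continuous_within_itvP _ t1)[+ _ _] :=
    parameterized_integral_continuous (ltW t1) (iF (t - 1) (t + 1)).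
  by apply; rewrite in_itv/=; apply/andP; split; lra.
have dF x y : t - 1 <= y -> y <= x -> `|prim x - prim y| <= `|F x - F y|.
  move=> ty yx; apply: (le_trans (norm_primB yx)).
  rewrite /F (@Rintegral_itvB _ _ (BLeft (t - 1)) (BRight x) y) ?bnd_simp//.
  exact: ler_norm.
apply/cvgrPdist_le => e e0; move/cvgrPdist_le : cF => /(_ _ e0) cF.
near=> x; apply: (@le_trans _ _ `|F t - F x|); last by near: x; exact: cF.
have tx : t - 1 <= x.
  have : ball t 1 x by near: x; apply/nbhs_ballP; exists 1 => //=.
  by rewrite -ball_normE /= ltr_norml => /andP[]; lra.
have [xt|tx'] := leP x t; first exact: dF.
by rewrite distrC (distrC (F t)); apply: dF; [lra|exact: ltW].
Unshelve. all: end_near. Qed.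

End Primitive.

Section ResolventContinuity.
Context {R : realType} {X : completeNormedModType R}.
Variable A : unbounded_operator X.
Hypothesis hrho : [set l : R | 0 < l] `<=` resolvent_set A.
Hypothesis hbound : forall l : R, 0 < l -> l * operator_norm (resolvent A l) <= 1.

Lemma norm_resolvent_le (l : R) x : 0 < l -> `|resolvent A l x| <= l^-1 * `|x|.
Proof.
by move=> l0; rewrite -ler_pdivrMl ?invr_gt0// invrK; exact: norm_resolvent.
Qed.

Lemma lipschitz_continuous (L : X -> X) (M : R) :
  (forall x y, `|L x - L y| <= M * `|x - y|) -> continuous L.
Proof.
move=> LM x; apply/cvgrPdist_lt => e e0.
have M0 : 0 < `|M| + 1 by rewrite ltr_wpDl.
near=> y; apply: (le_lt_trans (LM x y)).
apply: (@le_lt_trans _ _ ((`|M| + 1) * `|x - y|)).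
  by rewrite ler_wpM2r// ler_wpDr// ler_norm.
rewrite -ltr_pdivlMl//; near: y.
by apply: (@cvgr_dist_lt _ _ _ (nbhs x) _ id x) => //; rewrite mulr_gt0// invr_gt0.
Unshelve. all: end_near. Qed.

Lemma continuous_resolvent (l : R) : 0 < l -> continuous (resolvent A l).
Proof.
move=> l0; apply: (@lipschitz_continuous _ l^-1) => x y.
by rewrite -resolventB//; exact: norm_resolvent_le.
Qed.

End ResolventContinuity.

Section WeakEquation.
Context {R : realType} {X : completeNormedModType R}.
Variable ip : {dot X for (@idfun R)}.
Hypothesis hip : induces_norm ip.
Local Notation mu := (@lebesgue_measure R).
Variable A : unbounded_operator X.
Hypothesis hrho : [set l : R | 0 < l] `<=` resolvent_set A.
Hypothesis hbound : forall l : R, 0 < l -> l * operator_norm (resolvent A l) <= 1.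
Local Notation J := (resolvent A).
Variables (alpha T : R).
Hypotheses (alpha0 : 0 < alpha) (T0 : 0 < T).
Local Notation G := ((Gamma alpha)^-1).
Variables (a : X) (u w : R -> X).
Hypothesis uw : u = w %[ae mu in `]0, T[%classic].
Hypothesis iw : norm_integrable `]0, T[ w.
Hypothesis w0 : forall t, ~ `]0, T[%classic t -> w t = 0.
Hypothesis hweak : weak_solution ip T alpha A a u.

(** Integration by parts, carried out as Fubini on the triangle: (tau - t)^alpha / alpha is the
    integral of (tau - r)^(alpha - 1) over r in ]t, tau[. *)
Let prim_conv (z : X) (tau : R) : 0 < tau -> tau <= T ->
  \int[mu]_(t in `]0, tau[) (G * (tau - t) `^ alpha / alpha * ip (w t) z) =
  \int[mu]_(t in `]0, tau[) ((tau - t) `^ (alpha - 1) * (G * ip (prim ip w t) z)).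
Proof.
move=> tau0 tauT; have [nw _] := iw.
have iwD D := @norm_integrable_sub R X T w iw w0 D.
rewrite -(@triangle_fubini _ tau (G * tau `^ alpha / alpha)
  (fun t s => G * (tau - t) `^ (alpha - 1)) (fun s => G * (tau - s) `^ alpha / alpha)
  (fun t => ip (w t) z)).
- apply: eq_Rintegral => t _.
  rewrite (prim_oo hip iw w0) mulrA -RintegralZl//; last first.
    by apply: (integrable_ip hip) => //; exact: iwD.
  by apply: eq_Rintegral => s _; ring.
- apply: measurable_funM => //; apply: (measurableT_comp (measurable_powR _)).
  exact: measurable_funB.
- by move=> t s *; rewrite mulr_ge0 ?Gamma_ge0 ?powR_ge0.
- move=> s s0 st; under eq_integral do rewrite EFinM.
  rewrite EFin_integralZl//; last by apply: integrable_powRBl; rewrite ?alpha0 ?orbT ?gt_eqF.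
  rewrite integral_powRBl ?alpha0 ?orbT ?gt_eqF//.
  by rewrite subrr powR0 ?gt_eqF// subr0 -EFinM mulrA.
- move=> s s0 st; apply: ler_wpM2r; first by rewrite invr_ge0 ltW.
  apply: ler_wpM2l; first exact: Gamma_ge0.
  by apply: ge0_ler_powR; rewrite ?nnegrE ?subr_ge0 ?ltW// ltrBlDr ltrDl.
- exact: nice_ip.
- by apply: (integrable_ip hip) => //; exact: iwD.
Qed.

Lemma weak_integrated (l : R) (x : X) (tau : R) : 0 < l -> 0 < tau -> tau <= T ->
  ip (J l (prim ip w tau) - tau *: J l a) x =
  \int[mu]_(t in `]0, tau[) ((tau - t) `^ (alpha - 1) *
     (G * ip (l *: J l (prim ip w t) - prim ip w t) x)).
Proof.
move=> l0 tau0 tauT.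
have iwD D := @norm_integrable_sub R X T w iw w0 D.
have [J' HJ'] := adjointP hip (fun c x y => resolvent_lin hrho c x y l0)
  (fun x => norm_resolvent_le hrho hbound x l0).
(* [z] is the image of [y] under the adjoint of A, because J (A p) = l J p - p on the domain of
   A. *)
set y := J' x; pose z := l *: y - x.
have yz p : dom A p -> ip (A p) y = ip p z.
  move=> dp; rewrite -HJ' /z ipBr ipZr -HJ' -ipZl -ipBl; congr (ip _ x).
  have := resolvent_eq hrho l0 dp erefl.
  rewrite (resolventB hrho)// (resolventZ hrho)// => /eqP.
  by rewrite subr_eq => /eqP ->; rewrite addrAC subrr add0r.
have E := hweak (frac_adjoint hip T0 alpha0 y tau0 tauT)
  (pointwise_adjoint T0 (measurable_cutoff_int alpha tau) (cutoff_int_ge0 alpha0 tau)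
    (fun t t0 tT => cutoff_int_le (T := T) alpha0 tau0 t0 tT) yz).
have L : L2_dot ip T (fun t => u t - a) (fun t => cutoff tau t *: y) =
    ip (J l (prim ip w tau) - tau *: J l a) x.
  transitivity (\int[mu]_(t in `]0, T[) (cutoff tau t * ip (w t - a) y)).
    apply: ae_eq_Rintegral; apply: filterS uw; first exact: (ae_filter_ringOfSetsType mu).
    by move=> t h /h ->; rewrite ipZr.
  rewrite (@Rintegral_cutoff _ T tau _ (fun t => ip (w t) y - ip a y))//; last 2 first.
  - by move=> t t0 tt; rewrite /cutoff tt mul1r ipBl.
  - by move=> t tt; rewrite /cutoff ltNge tt mul0r.
  rewrite RintegralB//; last 2 first.
  - by apply: (integrable_ip hip) => //; exact: iwD.
  - by apply: (@continuous_integrable_itv _ (cst (ip a y))) => t; exact: cvg_cst.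
  rewrite Rintegral_cst//= lebesgue_measure_itv/= lte_fin tau0/= subr0.
  rewrite -(prim_oo hip iw w0) ipBl ipZl !HJ'.
  by rewrite mulrC.
rewrite -L E.
transitivity (\int[mu]_(t in `]0, T[) (cutoff_int alpha tau t * ip (w t) z)).
  apply: ae_eq_Rintegral; apply: filterS uw; first exact: (ae_filter_ringOfSetsType mu).
  by move=> t h /h ->; rewrite ipZr.
rewrite (@Rintegral_cutoff _ T tau _
  (fun t => G * (tau - t) `^ alpha / alpha * ip (w t) z))//; last 2 first.
- by move=> t t0 tt; rewrite /cutoff_int tt.
- by move=> t tt; rewrite /cutoff_int ltNge tt mul0r.
rewrite prim_conv//; apply: eq_Rintegral => t _; congr (_ * (_ * _)).
by rewrite /z ipBr ipZr -HJ' ipBl ipZl.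
Qed.

End WeakEquation.

(** * The maximum principle *)

Section Solutions.
Context {R : realType} {X : completeNormedModType R}.
Variable ip : {dot X for (@idfun R)}.
Hypothesis hip : induces_norm ip.
Local Notation mu := (@lebesgue_measure R).
Variable A : unbounded_operator X.
Hypothesis hrho : [set l : R | 0 < l] `<=` resolvent_set A.
Hypothesis hbound : forall l : R, 0 < l -> l * operator_norm (resolvent A l) <= 1.
Local Notation J := (resolvent A).
Variables (alpha T : R).
Hypotheses (alpha0 : 0 < alpha) (alpha1 : alpha < 1).
Local Notation G := ((Gamma alpha)^-1).

(* [f - phi a] is the fractional integral of [A f]; as [f] need not lie in the
   domain of [A], this is expressed after applying the resolvents. *)
Definition sol (a : X) (f : R -> X) (phi : R -> R) : Prop :=
  [/\ continuous f, continuous phi, (forall t, t <= 0 -> f t = 0 /\ phi t = 0) &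
    forall (l : R) x t, 0 < l -> 0 < t -> t <= T ->
      ip (J l (f t) - phi t *: J l a) x = \int[mu]_(s in `]0, t[)
        ((t - s) `^ (alpha - 1) * (G * ip (l *: J l (f s) - f s) x))].

Lemma integrable_conv (t : R) (g : R -> R) : continuous g ->
  mu.-integrable `]0, t[ (fun s => ((t - s) `^ (alpha - 1) * g s)%:E).
Proof.
move=> cg; have [t0|t0] := ltP 0 t; last first.
  by rewrite set_itv_ge ?bnd_simp -?leNgt//; exact: integrable_set0.
have [M M0 gM] := continuous_bounded_itv (ltW t0) cg.
apply: (@EFin_integrable_bounded _ _ _ _ M) => //.
- by apply: integrable_powRBl; rewrite ?alpha0 ?orbT ?gt_eqF.
- exact: continuous_measurable_fun.
- by move=> s /=; rewrite in_itv/= => /andP[s0 sr]; apply: gM; rewrite ltW.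
Qed.

(** Since A (J l y) = l J l y - y, this is G times the pairing of A (J l (f s)) with x. *)
Let flux (l : R) (f : R -> X) x s := G * ip (l *: J l (f s) - f s) x.

Lemma continuous_resolvent_comp (l : R) (f : R -> X) : 0 < l -> continuous f ->
  continuous (fun s => J l (f s)).
Proof.
move=> l0 cf s; exact: (cvg_comp _ _ (cf s) (continuous_resolvent hrho hbound l0 (x:=f s))).
Qed.

Lemma continuous_ip_comp (f : R -> X) x : continuous f -> continuous (fun s => ip (f s) x).
Proof. by move=> cf s; exact: (cvg_comp _ _ (cf s) (continuous_ipl hip (z:=x) (x:=f s))). Qed.

Let continuous_flux l f x : 0 < l -> continuous f -> continuous (flux l f x).
Proof.
move=> l0 cf s; apply: cvgMr; apply: continuous_ip_comp => r.
by apply: cvgB; [apply: cvgZr; exact: continuous_resolvent_comp|exact: cf].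
Qed.

Lemma sol_lin a f g phi psi (p q : R) : sol a f phi -> sol a g psi ->
  sol a (fun t => p *: f t + q *: g t) (fun t => p * phi t + q * psi t).
Proof.
move=> [cf cphi f0 fE] [cg cpsi g0 gE]; split.
- by move=> t; apply: cvgD; apply: cvgZr; [exact: cf|exact: cg].
- by move=> t; apply: cvgD; apply: cvgMr; [exact: cphi|exact: cpsi].
- by move=> t t0; have [-> ->] := f0 t t0; have [-> ->] := g0 t t0;
    rewrite !scaler0 !mulr0 !addr0.
move=> l x t l0 t0 tT.
have if_ := integrable_conv t (@continuous_flux l f x l0 cf).
have ig := integrable_conv t (@continuous_flux l g x l0 cg).
transitivity (p * ip (J l (f t) - phi t *: J l a) x + q * ip (J l (g t) - psi t *: J l a) x).
  rewrite (resolventD hrho)// !(resolventZ hrho)// !ipE; ring.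
rewrite fE// gE// -RintegralZl// -RintegralZl// -RintegralD//; last 2 first.
- exact: EFin_integrableZl.
- exact: EFin_integrableZl.
apply: eq_Rintegral => s _.
by rewrite (resolventD hrho)// !(resolventZ hrho)// !ipE; ring.
Qed.

(** Vanishing of f and phi up to time 0 makes the equation translation invariant: the delayed
    function has zero flux before h. *)
Lemma sol_shift a f phi (h : R) : 0 <= h -> sol a f phi ->
  sol a (fun t => f (t - h)) (fun t => phi (t - h)).
Proof.
move=> h0 [cf cphi f0 fE]; split.
- move=> t; apply: (cvg_comp _ f _ (cf (t - h))).
  by apply: cvgB; [exact: cvg_id|exact: cvg_cst].
- move=> t; apply: (cvg_comp _ phi _ (cphi (t - h))).
  by apply: cvgB; [exact: cvg_id|exact: cvg_cst].
- by move=> t t0; apply: f0; lra.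
move=> l x t l0 t0 tT.
have fl0 s : s <= h -> flux l f x (s - h) = 0.
  move=> sh; have [|fs _] := f0 (s - h); first lra.
  by rewrite /flux fs (resolvent0 hrho)// scaler0 subrr ip0l mulr0.
(* Cut to its interval, the integrand lives on the whole line, where the integral is invariant under
   translation. *)
pose H := (fun s => (t - h - s) `^ (alpha - 1) * flux l f x s) \_ `]0, t - h[.
have mH : measurable_fun [set: R] H.
  have mH0 : measurable_fun [set: R] (fun s => (t - h - s) `^ (alpha - 1) * flux l f x s).
    apply: measurable_funM.
      by apply: (measurableT_comp (measurable_powR _)); exact: measurable_funB.
    exact: continuous_measurable_fun (@continuous_flux l f x l0 cf).
  apply/(measurable_restrictT _ (measurable_itv _)).
  exact: measurable_funTS mH0.
transitivity (\int[mu]_s H s); last first.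
  rewrite -(Rintegral_shift h mH) [RHS]Rintegral_mkcond; apply: eq_Rintegral => s _.
  rewrite /H !patchE; have [sh|hs] := leP s h.
    rewrite memNset; last by rewrite /= in_itv/= subr_gt0 ltNge sh.
    by case: ifPn => // _; rewrite -/(flux l f x (s - h)) fl0// mulr0.
  rewrite !mem_setE !in_itv/= subr_gt0 hs ltrD2r (le_lt_trans h0 hs).
  by rewrite opprB addrA subrK.
rewrite -Rintegral_mkcond; have [th|ht] := ltP 0 (t - h).
  by rewrite fE//; lra.
have [-> ->] := f0 _ ht.
rewrite (resolvent0 hrho)// scale0r subrr ip0l.
by rewrite set_itv_ge ?bnd_simp -?leNgt// Rintegral_set0.
Qed.

(** The equation is tested against a vector, so L passes to that vector as its adjoint; commutation
    with the resolvents brings it back. *)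
Lemma sol_op a f phi (L : X -> X) (M : R) :
  (forall c x y, L (c *: x + y) = c *: L x + L y) ->
  (forall x, `|L x| <= M * `|x|) ->
  (forall l x, 0 < l -> L (J l x) = J l (L x)) ->
  sol a f phi -> sol (L a) (fun t => L (f t)) phi.
Proof.
move=> Llin LM LJ [cf cphi f0 fE].
have LD x y : L (x + y) = L x + L y by rewrite -[x]scale1r Llin !scale1r.
have L0 : L 0 = 0.
  have := LD 0 0; rewrite addr0 => /eqP; rewrite -subr_eq0 opprD addrA subrr sub0r.
  by rewrite oppr_eq0 => /eqP.
have LZ c x : L (c *: x) = c *: L x by rewrite -[c *: x]addr0 Llin L0 addr0.
have LB x y : L (x - y) = L x - L y by rewrite LD -scaleN1r LZ scaleN1r.
have [L' HL'] := adjointP hip Llin LM.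
split.
- have cL : continuous L by apply: (@lipschitz_continuous _ _ _ M) => x y; rewrite -LB.
  by move=> t; exact: (cvg_comp _ _ (cf t) (cL (f t))).
- exact: cphi.
- by move=> t /f0[-> ->]; rewrite L0.
move=> l x t l0 t0 tT.
rewrite -!LJ// -LZ -LB HL' fE//; apply: eq_Rintegral => s _.
by rewrite -HL' LB LZ -LJ.
Qed.

Let kap := alpha^-1 + (1 - alpha)^-1.

(** The norm of J f + (d - phi) J a is examined at a maximum point. The parameter d is 1 for a
    single difference quotient and 0 for the difference of two; E measures how far phi stays from d,
    the weight s^alpha coming from the bound at a maximum. *)
Lemma sol_max_principle a f phi (l d E : R) : 0 < T -> 0 < l -> 0 <= E -> sol a f phi ->
  (forall s, 0 < s -> s <= T -> s `^ alpha * `|d - phi s| <= E) ->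
  forall t, 0 <= t -> t <= T ->
  `|J l (f t) + (d - phi t) *: J l a| <=
    `|d| * `|J l a| + kap * G * E * `|A (J l a)|.
Proof.
move=> T0 l0 E0 [cf cphi f0 fE] phiE.
pose y t := J l (f t) + (d - phi t) *: J l a.
have cy : continuous y.
  move=> t; apply: cvgD; first exact: continuous_resolvent_comp.
  by apply: cvgZl; apply: cvgB; [exact: cvg_cst|exact: cphi].
have [ts tsT Hts] := @EVT_max R (fun s => `|y s|) 0 T (ltW T0)
   (continuous_subspaceT (fun x => cvg_norm (cy x))).
suff main : `|y ts| <= `|d| * `|J l a| + kap * G * E * `|A (J l a)|.
  move=> t t0 tT; apply: le_trans main; apply: (Hts t).
  by rewrite in_itv/= t0.
have G0 : 0 <= G by exact: Gamma_ge0.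
have kap0 : 0 <= kap by rewrite addr_ge0// invr_ge0 ?subr_ge0 ltW.
move: tsT; rewrite in_itv/= => /andP[]; rewrite le_eqVlt => /predU1P[<- _|ts0 tsT].
  have [f00 phi00] := f0 0 (lexx _).
  rewrite /y f00 phi00 (resolvent0 hrho)// add0r subr0 normrZ lerDl.
  by rewrite !mulr_ge0.
(* Testing with the maximal vector itself makes the problem scalar: by Cauchy-Schwarz, ip (y r) x is
   largest at r = ts, and F differs from it by a constant. *)
set x := y ts.
pose F r := ip (J l (f r) - phi r *: J l a) x.
have FE r : 0 < r -> r <= ts ->
    F r = \int[mu]_(s in `]0, r[) ((r - s) `^ (alpha - 1) * flux l f x s).
  by move=> r0 rt; rewrite /F fE// (le_trans rt).
have Fy r : F r = ip (y r - d *: J l a) x.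
  by rewrite /F /y scalerBl addrA addrAC addrK.
have cF : continuous F.
  apply: continuous_ip_comp => r; apply: cvgB; first exact: continuous_resolvent_comp.
  by apply: cvgZl; exact: cphi.
have Fmax r : 0 < r -> r <= ts -> F r <= F ts.
  move=> r0 rt; rewrite !Fy !ipBl lerD2r.
  apply: (le_trans (le_ip hip _ _)); rewrite -/x (ipxx hip) expr2.
  apply: ler_wpM2r => //; apply: (Hts r).
  by rewrite in_itv/= (ltW r0) (le_trans rt).
set B := G * (`|d - phi ts| * `|A (J l a)| * `|x|).
have B0 : 0 <= B by rewrite !mulr_ge0.
(* x lies in the domain even though f(ts) need not. The flux is G ip (A x - (d - phi) A J a) x,
   whose first term is at most 0 by dissipativity. *)
have fluxB : flux l f x ts <= B.
  rewrite /flux; apply: ler_wpM2l => //.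
  have dx : dom A x.
    rewrite /x /y addrC; apply: domP; exact: dom_resolvent.
  have Ax : A x = (d - phi ts) *: A (J l a) + (l *: J l (f ts) - f ts).
    rewrite /x /y addrC opfunP; [|exact: dom_resolvent..].
    by rewrite (op_resolvent hrho (f ts)).
  have -> : l *: J l (f ts) - f ts = A x - (d - phi ts) *: A (J l a).
    by rewrite Ax addrAC subrr add0r.
  rewrite ipBl ipZl.
  have := dissipative hrho hbound hip dx.
  have := norm_ip hip (A (J l a)) x.
  move/(ler_wpM2l (normr_ge0 (d - phi ts))); rewrite mulrA -normrM ler_norml => /andP[h _].
  lra.
have := frac_extremum alpha0 alpha1 ts0 cF (@continuous_flux l f x l0 cf) FE Fmax B0 fluxB.
rewrite -/kap Fy -/x ipBl ipZl (ipxx hip) => main.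
have [x0|x0] := eqVneq x 0.
  by rewrite x0 normr0 addr_ge0// !mulr_ge0.
have x0' : 0 < `|x| by rewrite normr_gt0.
rewrite -(ler_pM2r x0') -expr2.
have h1 : d * ip (J l a) x <= `|d| * `|J l a| * `|x|.
  rewrite -mulrA (le_trans (ler_norm _))// normrM ler_wpM2l//; exact: norm_ip.
have h2 : kap * ts `^ alpha * B <= kap * G * E * `|A (J l a)| * `|x|.
  have -> : kap * ts `^ alpha * B =
     kap * G * `|A (J l a)| * `|x| * (ts `^ alpha * `|d - phi ts|) by rewrite /B; ring.
  have -> : kap * G * E * `|A (J l a)| * `|x| = kap * G * `|A (J l a)| * `|x| * E by ring.
  by apply: ler_wpM2l; [rewrite !mulr_ge0|exact: phiE].
lra.
Qed.

End Solutions.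

(** * Difference quotients *)

Section Limits.
Context {R : realType} {X : completeNormedModType R}.
Local Notation mu := (@lebesgue_measure R).

Lemma powR_small (p C e : R) : 0 < p -> 0 < e ->
  exists2 d, 0 < d & forall x, 0 < x -> x < d -> C * x `^ p <= e.
Proof.
move=> p0 e0; have C0 : 0 < `|C| + 1 by rewrite ltr_wpDl.
have e1 : 0 < e / (`|C| + 1) by rewrite divr_gt0.
have /cvgrPdist_le/(_ _ e1)[d /= d0 Hd] := @powR_cvg0 R p p0.
exists d => // x x0 xd.
have := Hd x _ x0; rewrite /= !sub0r !normrN (gtr0_norm x0) => /(_ xd).
rewrite ger0_norm ?powR_ge0// => h.
apply: (@le_trans _ _ ((`|C| + 1) * x `^ p)).
  by rewrite ler_wpM2r ?powR_ge0// ler_wpDr// ler_norm.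
by rewrite mulrC -ler_pdivlMr.
Qed.

(* Cutting [[t - h, t]] into [n] pieces makes the higher order term negligible. *)
Lemma increment_bound (W : R -> X) (T b C p : R) : 0 < p -> 0 <= C ->
  (forall h t, 0 < h -> t <= T -> `|W t - W (t - h)| <= h * (b + C * h `^ p)) ->
  forall h t, 0 < h -> t <= T -> `|W t - W (t - h)| <= h * b.
Proof.
move=> p0 C0 HW h t h0 tT.
have sum k r : 0 < r -> `|W t - W (t - k%:R * r)| <= k%:R * (r * (b + C * r `^ p)).
  move=> r0; elim: k => [|k IH]; first by rewrite !mul0r subr0 subrr normr0.
  rewrite -(subrKA (W (t - k%:R * r))) (le_trans (ler_normD _ _))//.
  have S1 (x : R) : k.+1%:R * x = k%:R * x + x by rewrite -natr1 mulrDl mul1r.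
  rewrite !S1; apply: lerD => //.
  rewrite opprD addrA; apply: HW => //.
  by rewrite lerBlDr (le_trans tT)// lerDl mulr_ge0// ltW.
apply/ler_addgt0Pr => e e0.
have e1 : 0 < e / h by rewrite divr_gt0.
have [d d0 Hd] := powR_small C p0 e1.
have [N _ /(_ N (leqnn _)) /= HN] := near_infty_natSinv_lt (PosNum (divr_gt0 d0 h0)).
have r0 : 0 < h / N.+1%:R by rewrite divr_gt0.
have := sum N.+1 _ r0.
have -> : N.+1%:R * (h / N.+1%:R) = h by field; rewrite addrC natr1.
move/le_trans; apply.
rewrite mulrA (_ : N.+1%:R * (h / N.+1%:R) = h); last by field; rewrite addrC natr1.
rewrite mulrDr lerD2l -ler_pdivlMl// (mulrC _ e); apply: Hd => //.
by rewrite mulrC -ltr_pdivlMr.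
Qed.

Lemma ae_finite (Y : eqType) (S : set Y) (P : Y -> R -> Prop) : finite_set S ->
  (forall z, S z -> {ae mu, forall t, P z t}) ->
  {ae mu, forall t, forall z, S z -> P z t}.
Proof.
move=> /finite_seqP[s ->]; elim: s => [_|z s IH H].
  by apply: aeW => t z.
have h1 := H z (mem_head _ _).
have h2 : {ae mu, forall t, forall z, z \in s -> P z t}.
  by apply: IH => y ys; apply: H; rewrite /= inE ys orbT.
apply: filterS2 h1 h2; first exact: (ae_filter_ringOfSetsType mu).
by move=> t Pz Ps y; rewrite /= inE => /predU1P[->//|]; exact: Ps.
Qed.

(** The increments - 1 / (n + 1) are one particular way of approaching 0. *)
Lemma backward_quotient (F : R -> R) (t : R) : derivable F t 1 ->
  n.+1%:R * (F t - F (t - n.+1%:R^-1)) @[n --> \oo] --> F^`()%classic t.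
Proof.
move=> dF; have : h^-1 *: (F (h *: 1 + t) - F t) @[h --> 0^'] --> F^`()%classic t.
  by rewrite derive1E; exact: dF.
move=> /cvgrPdist_lt H; apply/cvgrPdist_lt => e /H[d /= d0 Hd].
have [N _ HN] := near_infty_natSinv_lt (PosNum d0).
exists N => // n /HN /= Nn.
have := Hd (- n.+1%:R^-1); rewrite /= sub0r opprK ger0_norm// => /(_ Nn).
rewrite oppr_eq0 invr_eq0 pnatr_eq0 => /(_ isT).
rewrite /GRing.scale /= mulr1 (addrC _ t) invrN invrK mulNr -mulrN opprB.
by [].
Qed.

Lemma cvg_dist_le (y : nat -> X) (l x : X) (e : R) : y @ \oo --> l ->
  (\forall k \near \oo, `|x - y k| <= e) -> `|x - l| <= e.
Proof. by move=> yl; apply: cvgr_to_le; apply: cvg_norm; apply: cvgB => //; exact: cvg_cst. Qed.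

Lemma uniform_cauchy_cvg (y : nat -> R -> X) : (forall k, continuous (y k)) ->
  (forall e, 0 < e -> exists N, forall i j t, (N <= i)%N -> (N <= j)%N ->
    `|y i t - y j t| <= e) ->
  exists2 v, continuous v & forall t, y k t @[k --> \oo] --> v t.
Proof.
move=> cy uy; pose v t := lim (y k t @[k --> \oo]).
have yv t : y k t @[k --> \oo] --> v t.
  by apply: cauchy_seq_cvg => e /uy[N HN]; exists N => i j; exact: HN.
exists v => // t; apply/cvgrPdist_le => e e0.
have [N HN] := uy _ (divr_gt0 e0 (ltr0n _ 3)).
have yNv r : `|y N r - v r| <= e / 3.
  by apply: cvg_dist_le (yv r) _; exists N => // k /=; exact: HN.
have /cvgrPdist_le/(_ _ (divr_gt0 e0 (ltr0n _ 3))) := cy N t.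
apply: filterS => r yr.
rewrite -(subrKA (y N t)) -(subrKA (y N r) (y N t)).
have n1 := ler_normD (v t - y N t) (y N t - y N r + (y N r - v r)).
have n2 := ler_normD (y N t - y N r) (y N r - v r).
have := yNv t; rewrite distrC; have := yNv r; lra.
Qed.

End Limits.

Section MainArgument.
Context {R : realType} {X : completeNormedModType R}.
Variable ip : {dot X for (@idfun R)}.
Hypothesis hip : induces_norm ip.
Local Notation mu := (@lebesgue_measure R).
Variable A : unbounded_operator X.
Hypothesis hdense : densely_defined A.
Hypothesis hrho : [set l : R | 0 < l] `<=` resolvent_set A.
Hypothesis hbound : forall l : R, 0 < l -> l * operator_norm (resolvent A l) <= 1.
Local Notation J := (resolvent A).
Variables (alpha T : R).
Hypotheses (alpha0 : 0 < alpha) (alpha1 : alpha < 1) (T0 : 0 < T).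
Local Notation G := ((Gamma alpha)^-1).
Variables (a : X) (u w : R -> X).
Hypothesis uw : u = w %[ae mu in `]0, T[%classic].
Hypothesis iw : norm_integrable `]0, T[ w.
Hypothesis w0 : forall t, ~ `]0, T[%classic t -> w t = 0.
Hypothesis hweak : weak_solution ip T alpha A a u.

Let V := prim ip w.
Let pos (t : R) := Num.max t 0.

Let cV : continuous V.
Proof. exact (prim_continuous hip iw w0). Qed.

Let cpos : continuous pos.
Proof. by move=> t; apply: continuous_max; [exact: cvg_id|exact: cvg_cst]. Qed.

Let sol_prim : sol ip A alpha T a V pos.
Proof.
split; [exact: cV|exact: cpos| |].
  by move=> t t0; rewrite /V (prim_le0 hip iw w0)// /pos; split=> //; apply/max_idPr.
move=> l x t l0 t0 tT; rewrite /pos (max_idPl (ltW t0)).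
exact: (weak_integrated hip hrho hbound alpha0 T0 uw iw w0 hweak).
Qed.

(** Difference quotients of V and of the positive part, written as linear combinations of a solution
    and its delay to match [sol_lin] and [sol_shift]. *)
Let quot (h t : R) : X := h^-1 *: V t + (- h^-1) *: V (t - h).
Let phi (h t : R) : R := h^-1 * pos t + (- h^-1) * pos (t - h).
Let Y (h t : R) : X := quot h t + (1 - phi h t) *: a.
(* [V] continued by [t a] to negative times; its difference quotients are [Y]. *)
Let Vext (t : R) : X := V t + (t - pos t) *: a.

Let sol_quot h : 0 < h -> sol ip A alpha T a (quot h) (phi h).
Proof.
move=> h0.
exact (sol_lin hip hrho hbound alpha0 h^-1 (- h^-1) sol_prim
  (sol_shift hip hrho hbound (ltW h0) sol_prim)).
Qed.

Let Y_Vext h t : 0 < h -> h *: Y h t = Vext t - Vext (t - h).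
Proof.
move=> h0; have hn : h != 0 by rewrite gt_eqF.
rewrite /Y /quot /Vext /phi !scalerDr !scalerA mulrN mulfV// scale1r scaleN1r.
rewrite [- (V (t - h) + _)]opprD [RHS]addrACA -scalerBl; congr (_ + _ *: _).
by field.
Qed.

Let Y_le0 h t : 0 < h -> t <= 0 -> Y h t = a.
Proof.
move=> h0 t0; have [_ _ f0 _] := sol_quot h0.
by rewrite /Y; have [-> ->] := f0 t t0; rewrite add0r subr0 scale1r.
Qed.

Let phi_one h t : 0 < h -> h <= t -> phi h t = 1.
Proof.
move=> h0 ht; rewrite /phi /pos (max_idPl (le_trans (ltW h0) ht)).
by rewrite (max_idPl _) ?subr_ge0//; field; rewrite gt_eqF.
Qed.

Let phi_itv h t : 0 < h -> 0 <= t -> 0 <= phi h t <= 1.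
Proof.
move=> h0 t0; have [ht|th] := leP h t; first by rewrite phi_one// ler01 lexx.
rewrite /phi /pos (max_idPl t0) (max_idPr _) ?subr_le0 ?(ltW th)// mulr0 addr0.
by rewrite mulr_ge0 ?invr_ge0 ?(ltW h0)//= ler_pdivrMl// mulr1 ltW.
Qed.

(** Supplies E in the maximum principle: x is a deviation of phi from d, at most 1 and absent from
    time H on. *)
Let weight_bound (H x s : R) : 0 < H -> 0 < s -> `|x| <= 1 -> (H <= s -> x = 0) ->
  s `^ alpha * `|x| <= H `^ alpha.
Proof.
move=> H0 s0 x1 xz; have [Hs|sH] := leP H s.
  by rewrite xz// normr0 mulr0 powR_ge0.
apply: (@le_trans _ _ (s `^ alpha * 1)); first by rewrite ler_wpM2l ?powR_ge0.
by rewrite mulr1; apply: ge0_ler_powR; rewrite ?nnegrE ltW.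
Qed.

Let K := (alpha^-1 + (1 - alpha)^-1) * G.

Let K0 : 0 <= K.
Proof.
by rewrite mulr_ge0 ?Gamma_ge0 ?addr_ge0 ?invr_ge0 ?subr_ge0 ?(ltW alpha0) ?(ltW alpha1).
Qed.

(** The maximum principle with d = 1 and datum L a; at times t <= 0, Y is the constant a.
    Nonpositive times are included because the subdivision of increments reaches them. *)
Let quot_op_bound (L : X -> X) (M l : R) :
  (forall c x y, L (c *: x + y) = c *: L x + L y) ->
  (forall x, `|L x| <= M * `|x|) ->
  (forall l x, 0 < l -> L (J l x) = J l (L x)) -> 0 < l ->
  forall h t, 0 < h -> t <= T ->
  `|J l (L (Y h t))| <= `|J l (L a)| + K * `|A (J l (L a))| * h `^ alpha.
Proof.
move=> Llin LM LJ l0 h t h0 tT.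
have [t0|/ltW t0] := leP t 0.
  by rewrite Y_le0// lerDl; apply: mulr_ge0; [exact: mulr_ge0|exact: powR_ge0].
have := sol_max_principle hip hrho hbound alpha0 alpha1 T0 l0 (powR_ge0 h alpha)
  (sol_op hip Llin LM LJ (sol_quot h0)) (d := 1) _ t0 tT.
have -> : J l (L (quot h t)) + (1 - phi h t) *: J l (L a) = J l (L (Y h t)).
  by rewrite /Y (addrC (quot h t)) (Llin (1 - phi h t) a) (resolvent_lin hrho)// addrC.
rewrite normr1 mul1r mulrAC; apply => s s0 sT; apply: weight_bound => //.
  have /andP[p0 p1] := phi_itv h0 (ltW s0).
  by rewrite ger0_norm ?subr_ge0// gerBl.
by move=> hs; rewrite phi_one// subrr.
Qed.

(** Under a fixed resolvent, [increment_bound] removes the error in h^alpha, because J L Y is the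
    difference quotient of J L Vext. Only then is the resolvent removed. *)
Let quot_op_le (L : X -> X) (M : R) :
  (forall c x y, L (c *: x + y) = c *: L x + L y) ->
  (forall x, `|L x| <= M * `|x|) ->
  (forall l x, 0 < l -> L (J l x) = J l (L x)) ->
  forall h t, 0 < h -> t <= T -> `|L (Y h t)| <= `|L a|.
Proof.
move=> Llin LM LJ h t h0 tT.
have bJ l : 0 < l -> `|J l (L (Y h t))| <= `|J l (L a)|.
  move=> l0.
  have JLlin c x y : J l (L (c *: x + y)) = c *: J l (L x) + J l (L y).
    by rewrite Llin (resolvent_lin hrho).
  have JL0 : J l (L 0) = 0.
    by have := JLlin (-1) 0 0; rewrite scaler0 addr0 scaleN1r addNr.
  have JLE r s : 0 < r -> `|J l (L (Vext s)) - J l (L (Vext (s - r)))| = r * `|J l (L (Y r s))|.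
    move=> r0; rewrite -(addrC (- _)) -scaleN1r -JLlin scaleN1r addrC -Y_Vext//.
    by rewrite -[r *: _]addr0 JLlin JL0 addr0 normrZ gtr0_norm.
  rewrite -(ler_pM2l h0) -JLE//.
  apply: (@increment_bound _ _ (fun s => J l (L (Vext s))) T _ _ _ alpha0
    (mulr_ge0 K0 (normr_ge0 (A (J l (L a))))) _ _ _ h0 tT).
  move=> r s r0 sT; rewrite JLE// ler_wpM2l ?(ltW r0)//.
  exact: (quot_op_bound Llin LM LJ l0 r0 sT).
(* Multiplying by l = N + 1 gives |l J (L Y)| <= |l J (L a)| <= |L a|, and l J (L Y) is within e of
   L Y for N large. *)
apply/ler_addgt0Pr => e e0.
have [N /(_ N (leqnn _))] := yosida_cvg hrho hbound hdense (L (Y h t)) e0.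
have N0 : 0 < N.+1%:R :> R by [].
have := norm_resolvent hrho hbound (L a) N0.
have := bJ _ N0; rewrite -(ler_pM2l N0) => /le_trans/[apply].
rewrite -[X in X * _](gtr0_norm N0) -normrZ distrC => le1 le2.
rewrite -[L (Y h t)](subrK (N.+1%:R *: J N.+1%:R (L (Y h t)))) addrC.
by rewrite (le_trans (ler_normD _ _))// lerD.
Qed.

(** Both quotients carry the same datum, so d = 0 leaves only the error term: the difference of the
    two phi vanishes from time H on. *)
Let quot_cauchy_resolvent (H l h h' t : R) : 0 < l -> 0 < h -> h <= H -> 0 < h' -> h' <= H ->
  0 <= t -> t <= T ->
  `|J l (Y h t - Y h' t)| <= K * `|A (J l a)| * H `^ alpha.
Proof.
move=> l0 h0 hH h'0 h'H t0 tT.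
have H0 : 0 < H by exact: lt_le_trans hH.
have S := sol_lin hip hrho hbound alpha0 1 (-1) (sol_quot h0) (sol_quot h'0).
have := @sol_max_principle _ _ _ hip _ hrho hbound _ _ alpha0 alpha1 _ _ _ l 0 _ T0 l0
  (powR_ge0 H alpha) S _ _ t0 tT.
have -> : J l (1 *: quot h t + -1 *: quot h' t) +
    (0 - (1 * phi h t + -1 * phi h' t)) *: J l a = J l (Y h t - Y h' t).
  rewrite addrC -(resolvent_lin hrho)//; congr J.
  rewrite /Y !scale1r !scaleN1r [- (quot h' t + _)]opprD [RHS]addrACA -scalerBl [LHS]addrC.
  by congr (_ + _ *: _); ring.
rewrite normr0 mul0r add0r mulrAC; apply => s s0 sT; apply: weight_bound => //.
  have /andP[p0 p1] := phi_itv h0 (ltW s0).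
  have /andP[p2 p3] := phi_itv h'0 (ltW s0).
  by rewrite ler_norml; apply/andP; split; lra.
by move=> Hs; rewrite !phi_one ?(le_trans _ Hs)//; lra.
Qed.

Let quot_cauchy e : 0 < e -> exists2 H, 0 < H & forall h h' t,
  0 < h -> h <= H -> 0 < h' -> h' <= H -> 0 <= t -> t <= T -> `|Y h t - Y h' t| <= e.
Proof.
move=> e0; have e3 : 0 < e / 3 by rewrite divr_gt0.
have [N /(_ N (leqnn _))] := yosida_cvg hrho hbound hdense a e3.
set l : R := N.+1%:R => La.
have l0 : 0 < l by [].
(* l is already fixed by the smallness of L a; the step size comes after it, since |A (J l a)|
   depends on l. *)
have [d d0 Hd] := powR_small (l * (K * `|A (J l a)|)) alpha0 e3.
exists (d / 2) => [|h h' t h0 hH h'0 h'H t0 tT]; first by rewrite divr_gt0.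
have H0 : 0 < d / 2 by rewrite divr_gt0.
have {}Hd : l * (K * `|A (J l a)| * (d / 2) `^ alpha) <= e / 3.
  by rewrite mulrA; apply: Hd => //; rewrite ltr_pdivrMr// mulr_natr mulr2n ltrDl.
pose L x := l *: J l x - x.
have Llin c x y : L (c *: x + y) = c *: L x + L y.
  rewrite /L (resolvent_lin hrho)// scalerDr !scalerA (mulrC l) -scalerA.
  by rewrite opprD addrACA scalerBr.
have LM x : `|L x| <= 2 * `|x|.
  rewrite (le_trans (ler_normB _ _))// normrZ (gtr0_norm l0) mulr2n mulrDl mul1r lerD//.
  exact: norm_resolvent.
have LJ m x : 0 < m -> L (J m x) = J m (L x).
  by move=> m0; rewrite /L (resolventB hrho)// (resolventZ hrho)// (resolventC hrho).
have Lle r := quot_op_le Llin LM LJ r tT.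
have JD := quot_cauchy_resolvent l0 h0 hH h'0 h'H t0 tT.
have -> : Y h t - Y h' t = l *: J l (Y h t - Y h' t) - (L (Y h t) - L (Y h' t)).
  have -> : L (Y h t) - L (Y h' t) = L (Y h t - Y h' t).
    by rewrite -[- Y h' t]scaleN1r [in RHS]addrC Llin scaleN1r addrC.
  by rewrite /L opprB addrCA subrr addr0.
have n1 := ler_normB (l *: J l (Y h t - Y h' t)) (L (Y h t) - L (Y h' t)).
have n2 := ler_normB (L (Y h t)) (L (Y h' t)).
have n3 := Lle h h0; have n4 := Lle h' h'0.
have n5 : `|l *: J l (Y h t - Y h' t)| <= e / 3.
  by rewrite normrZ gtr0_norm// (le_trans _ Hd)// ler_wpM2l// ltW.
have n6 : `|L a| <= e / 3 by [].
lra.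
Qed.

(** The projection onto [0, T]: composing with it turns uniform estimates on [0, T] into estimates
    on the whole line. *)
Let clamp (t : R) := Num.max 0 (Num.min t T).

Let cY h : 0 < h -> continuous (Y h).
Proof.
move=> h0; have [cq cp _ _] := sol_quot h0.
move=> t; apply: cvgD; first exact: cq.
by apply: cvgZl; apply: cvgB; [exact: cvg_cst|exact: cp].
Qed.

Let v_ex : exists2 v : R -> X, continuous v &
  forall t, 0 <= t -> t <= T -> Y k.+1%:R^-1 t @[k --> \oo] --> v t.
Proof.
have cclamp : continuous clamp.
  move=> t; apply: (@continuous_max R R (fun=> 0) (fun t => Num.min t T)); first exact: cvg_cst.
  by apply: (@continuous_min R R id (fun=> T)); [exact: cvg_id|exact: cvg_cst].
have [|e e0|v cv yv] := @uniform_cauchy_cvg R X (fun k t => Y k.+1%:R^-1 (clamp t)).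
- move=> k t; have k0 : 0 < (k.+1%:R^-1 : R) by rewrite invr_gt0.
  exact (@cvg_comp _ _ _ clamp (Y k.+1%:R^-1) _ _ _ (cclamp t) (cY k0 (x:=clamp t))).
- have [H H0 HY] := quot_cauchy e0.
  have [N _ HN] := near_infty_natSinv_lt (PosNum H0).
  exists N => i j t Ni Nj; apply: HY; rewrite ?invr_gt0//.
  + exact/ltW/(HN i).
  + exact/ltW/(HN j).
  + by rewrite /clamp le_max lexx.
  + by rewrite /clamp ge_max ge_min lexx orbT andbT ltW.
exists v => // t t0 tT; have := yv t.
by rewrite /clamp (min_idPl tT) (max_idPr t0).
Qed.

(** Lebesgue differentiation of the scalar primitive; the exceptional null set depends on z. *)
Let prim_quotient z : {ae mu, forall t,
  ip (quot k.+1%:R^-1 t) z @[k --> \oo] --> ip (w t) z}.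
Proof.
have iz D : measurable D -> mu.-integrable D (EFin \o (fun s => ip (w s) z)).
  by move=> mD; exact: (integrable_ip hip mD z (norm_integrable_sub iw w0 mD)).
have : {ae mu, forall t, derivable (fun x => ip (V x) z) t 1 /\
    (fun x => ip (V x) z)^`()%classic t = ip (w t) z}.
  rewrite (_ : (fun x => _) = fun x => \int[mu]_(s in `]-oo, x]) ip (w s) z); last first.
    by apply/funext => x; exact: (primP hip iw w0).
  apply: FTC1Ny => [y|]; first by apply: iz; exact: measurable_itv.
  exact: (open_integrable_locally openT (iz _ measurableT)).
apply: filterS; first exact: (ae_filter_ringOfSetsType mu).
move=> t [dV <-]; have := backward_quotient dV.
apply: cvg_trans; apply: near_eq_cvg; apply: nearW => k.
by rewrite /quot invrK ipDl !ipZl mulNr mulrBr.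
Qed.

(** The null sets in [prim_quotient] depend on z, and X is not assumed separable. Only the countably
    many values of the simple functions approximating w are therefore used as z; their closed span
    contains the values of w, of V and of v on ]0, T[, which suffices to identify v with w. *)
Lemma weak_solution_continuous : exists v : R -> X,
  [/\ u = v %[ae mu in `]0, T[%classic], continuous v & v 0 = a].
Proof.
have [v cv Yv] := v_ex; exists v; split=> //; last first.
  have := Yv 0 (lexx _) (ltW T0); under eq_fun do rewrite Y_le0//.
  move/(cvg_unique _ (cvg_cst a)) => /(_ _) <-//.
have qv t z : 0 < t -> t < T -> ip (quot k.+1%:R^-1 t) z @[k --> \oo] --> ip (v t) z.
  move=> t0 tT; have := cvg_comp _ _ (Yv t (ltW t0) (ltW tT)) (continuous_ipl hip (z:=z) (x:=v t)).
  apply: cvg_trans; apply: near_eq_cvg.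
  have [N _ HN] := near_infty_natSinv_lt (PosNum t0).
  (* At a fixed t > 0, [phi] equals 1 once the step is at most t, and Y is the plain quotient. *)
  exists N => // k Nk /=; rewrite /Y phi_one ?invr_gt0//; last exact/ltW/(HN k).
  by rewrite subrr scale0r addr0.
have [[s [fs sw]] _] := iw.
have aeQ : {ae mu, forall t n z, (range (s n)) z ->
    ip (quot k.+1%:R^-1 t) z @[k --> \oo] --> ip (w t) z}.
  apply: ae_foralln => n; apply: ae_finite; first by have [] := fs n.
  by move=> z _; exact: prim_quotient.
apply: filterS2 uw aeQ; first exact: (ae_filter_ringOfSetsType mu).
move=> t ut Qt /[dup] tI /= /[!in_itv] /= /andP[t0 tT]; rewrite ut//.
apply/eqP; rewrite -subr_eq0; set p := w t - v t.
have pz n r : ip p (s n r) = 0.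
  by rewrite /p ipBl (cvg_unique _ (Qt n (s n r) _) (qv t (s n r) t0 tT)) ?subrr//; exists r.
have wp r : ip (w r) p = 0.
  have : ip (s n r) p @[n --> \oo] --> ip (w r) p.
    exact: (cvg_comp _ _ (sw r) (continuous_ipl hip (z:=p) (x:=w r))).
  rewrite (_ : (fun n => _) = cst 0); last by apply/funext => n; rewrite ipC pz.
  by move/(cvg_unique _ (cvg_cst 0)) => <-.
(* p is orthogonal to all w r, hence to V, to its quotients and to their limit v t; so p = w t - v t
   is orthogonal to itself. *)
have Vp r : ip (V r) p = 0.
  by rewrite /V (primP hip iw w0) /Rintegral integral0_eq// => ? _; rewrite wp.
have vp : ip (v t) p = 0.
  have := qv t p t0 tT; rewrite (_ : (fun n => _) = cst 0); last first.
    by apply/funext => k; rewrite /quot ipDl !ipZl !Vp !mulr0 addr0.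
  by move/(cvg_unique _ (cvg_cst 0)) => <-.
have : ip p p = 0 by rewrite {1}/p ipBl wp vp subrr.
by rewrite (ipxx hip) => /eqP; rewrite expf_eq0/= normr_eq0.
Qed.

End MainArgument.

Theorem theorem2p4 (R : realType) (X : completeNormedModType R)
    (ip : {dot X for (@idfun R)}) (hip : induces_norm ip)
    (alpha : R) (halpha0 : 0 < alpha) (halpha1 : alpha < 1)
    (T : R) (hT : 0 < T)
    (A : unbounded_operator X)
    (hclosed : closed_operator A) (hdense : densely_defined A)
    (hrho : [set l : R | 0 < l] `<=` resolvent_set A)
    (hbound : forall l : R, 0 < l -> l * operator_norm (resolvent A l) <= 1)
    (a : X) (u : R -> X) (hu : L2 T u)
    (hweak : weak_solution ip T alpha A a u) :
  exists v : R -> X,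
    [/\ u = v %[ae (@lebesgue_measure R) in `]0, T[%classic],
        {within `[0, T], continuous v} &
        v 0 = a].
Proof.
have [w [_ w0 iw uw]] := L2_nice hu.
have [v [uv cv va]] :=
  weak_solution_continuous hip hdense hrho hbound halpha0 halpha1 hT uw iw w0 hweak.
by exists v; split=> //; exact: continuous_subspaceT.
Qed.
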